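(* For every $k\in\mathbb{N}_0$, \[ \inf_{\mathsf A\in\mathcal{A}_{k,\mu,L}}\mathcal{R}_{k,\mu,L}(\mathsf A)=\frac{1}{1+qA_k}. \] Moreover, for each $k\in\mathbb{N}_0$ the infimum is attained by Prox-ITEM run for $k$ iterations with input $x^0=u^0$ and output $u^k=z^k$.
   Context: Let $0<\mu<L<+\infty$ and $q=\mu/L$. For $0\le\mu\le L\le+\infty$ ($\mu<+\infty$), $\mathcal{F}_{\mu,L}(\mathcal{H})$ denotes the class of proper lower semicontinuous functions $h:\mathcal{H}\to\mathbb{R}\cup\{+\infty\}$ on a real Hilbert space $\mathcal{H}$ that are $\mu$-strongly convex and, if $L<+\infty$, $L$-smooth (Fréchet differentiable with $L$-Lipschitz gradient). For $g$ proper convex lsc and $\gamma>0$, $\operatorname{Prox}^{\gamma}_g(x)=\operatorname{argmin}_z\big(g(z)+\tfrac{1}{2\gamma}\|x-z\|^2\big)$. The scalar sequence $(A_k)_{k\in\mathbb{N}_0}$ is defined by $A_0=0$ and \[ A_{k+1}=\frac{(1+q)A_k+2\big(1+\sqrt{(1+A_k)(1+qA_k)}\big)}{(1-q)^2}. \] Prox-ITEM: given $f\in\mathcal{F}_{\mu,L}(\mathcal{H})$, $g\in\mathcal{F}_{0,\infty}(\mathcal{H})$, $x^0\in\mathcal{H}$, set $z^0=x^0$ and for $k=0,1,2,\dots$: $\beta_k=\frac{A_k}{(1-q)A_{k+1}}$, $\delta_k=\sqrt{\frac{A_{k+1}}{1+qA_{k+1}}}$, $y^k=(1-\beta_k)z^k+\beta_k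 x^k$, $\bar z^{k+1}=(1-q\delta_k)z^k+q\delta_k y^k-\frac{\delta_k}{L}\nabla f(y^k)$, $z^{k+1}=\operatorname{Prox}^{\delta_k/L}_g(\bar z^{k+1})$, $x^{k+1}=y^k-\frac1L\nabla f(y^k)-\frac{1}{\delta_k}(\bar z^{k+1}-z^{k+1})$. Algorithm class $\mathcal{A}_{k,\mu,L}$ (fixed $k\in\mathbb{N}_0$): a method $\mathsf A$ takes $u^0\in\mathcal{H}$ and returns $\mathsf A(f,g,u^0)=u^k$ as follows: $v^0=u^0$; choose $m\in\mathbb{N}_0$ with $m\ge k$ and $\theta\in\{0,1\}^{\{0,\dots,m-1\}}$ with $\sum_{\ell=0}^{m-1}\theta_\ell=k$; for each $\ell\in\{0,\dots,m-1\}$, $s^\ell=\nabla f(v^\ell)$ if $\theta_\ell=1$, and $s^\ell=\gamma_\ell^{-1}\big(v^\ell-\operatorname{Prox}^{\gamma_\ell}_g(v^\ell)\big)$ (an element of $\partial g(\operatorname{Prox}^{\gamma_\ell}_g(v^\ell))$) for some $\gamma_\ell>0$ if $\theta_\ell=0$; $v^\ell\in u^0+\operatorname{span}\{s^i: 0\le i\le \ell-1\}$ for $\ell\in\{1,\dots,m-1\}$; and $u^k\in u^0+\operatorname{span}\{s^i:0\le i\le m-1\}$ (with $\operatorname{span}\emptyset=\{0\}$). Thus methods use $k$ gradient calls for $f$ and arbitrarily many proximal calls for $g$. Worst-case risk: $\mathcal{R}_{k,\mu,L}(\mathsf A)=\sup \frac{\|\mathsf A(f,g,u^0)-u^\star\|^2}{\|u^0-u^\star\|^2}$,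 the supremum over all real Hilbert spaces $\mathcal{H}$, $f\in\mathcal{F}_{\mu,L}(\mathcal{H})$, $g\in\mathcal{F}_{0,\infty}(\mathcal{H})$, $u^\star\in\operatorname{argmin}(f+g)$, and $u^0\in\mathcal{H}$ with $u^0\ne u^\star$. *)

(* Defs.v *)
From HB Require Import structures.
From mathcomp Require Import all_boot all_order all_algebra.
From mathcomp Require Import all_classical all_reals all_analysis.
Set Implicit Arguments. Unset Strict Implicit. Unset Printing Implicit Defensive.
Import Order.TTheory GRing.Theory Num.Theory.
Import numFieldNormedType.Exports.
Local Open Scope classical_set_scope.
Local Open Scope ring_scope.

Record hilbertSpace (R : realType) := HilbertSpace {
  hcar :> completeNormedModType R;
  hinner : hcar -> hcar -> R;
  hinner_sym : forall x y, hinner x y = hinner y x;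
  hinner_linl : forall (a : R) (x y z : hcar),
      hinner (a *: x + y) z = a * hinner x z + hinner y z;
  hnorm_inner : forall x : hcar, `|x| ^+ 2 = hinner x x }.

Section Defs.
Variable R : realType.

Section OnSpace.
Variable H : hilbertSpace R.
Local Notation "<< x , y >>" := (hinner x y).

Definition frechet_grad (h : H -> \bar R) (x s : H) : Prop :=
  h x \is a fin_num /\
  forall eps : R, 0 < eps -> exists2 delta : R, 0 < delta &
    forall d : H, `|d| < delta ->
      h (x + d) \is a fin_num /\
      `| fine (h (x + d)) - fine (h x) - << s, d >> | <= eps * `|d|.

Definition proper_fun (h : H -> \bar R) : Prop :=
  (exists x, h x != +oo%E) /\ (forall x, h x != -oo%E).

Definition lsc_fun (h : H -> \bar R) : Prop :=
  forall (x : H) (r : R), (r%:E < h x)%E ->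
    exists2 delta : R, 0 < delta &
      forall y : H, `|y - x| < delta -> (r%:E < h y)%E.

Definition strongly_convex (mu : R) (h : H -> \bar R) : Prop :=
  forall (x y : H) (t : R), 0 < t < 1 ->
    (h (t *: x + (1 - t) *: y)%R <=
      t%:E * h x + (1 - t)%:E * h y
      - (mu / 2 * t * (1 - t) * `|x - y| ^+ 2)%:E)%E.

(* The class F_{mu,L}(H); L = +oo means no smoothness requirement. *)
Definition Fclass (mu : R) (L : \bar R) (h : H -> \bar R) : Prop :=
  [/\ proper_fun h, lsc_fun h, strongly_convex mu h &
      forall l : R, L = l%:E ->
        exists G : H -> H, (forall x, frechet_grad h x (G x)) /\
          (forall x y, `|G x - G y| <= l * `|x - y|)].

(* the gradient (chosen by description; unique when it exists) *)
Definition grad (h : H -> \bar R) (x : H) : H :=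
  xget 0 [set s | frechet_grad h x s].

Definition is_prox (g : H -> \bar R) (gamma : R) (x z : H) : Prop :=
  forall w : H,
    (g z + (1 / (2 * gamma) * `|x - z| ^+ 2)%:E <=
     g w + (1 / (2 * gamma) * `|x - w| ^+ 2)%:E)%E.

Definition prox (g : H -> \bar R) (gamma : R) (x : H) : H :=
  xget 0 [set z | is_prox g gamma x z].

Definition is_argmin (h : H -> \bar R) (u : H) : Prop :=
  forall x : H, (h u <= h x)%E.

Definition in_span (s : nat -> H) (n : nat) (x : H) : Prop :=
  exists c : nat -> R, x = \sum_(i < n) c i *: s i.

End OnSpace.

Definition method := forall H : hilbertSpace R,
  (H -> \bar R) -> (H -> \bar R) -> H -> H.

Definition in_alg_class (k : nat) (mu L : R) (A : method) : Prop :=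
  forall (H : hilbertSpace R) (f g : H -> \bar R) (u0 : H),
    Fclass mu L%:E f -> Fclass 0 +oo%E g ->
    exists (m : nat) (theta : nat -> bool) (gamma : nat -> R)
           (v s : nat -> H),
      [/\ (k <= m)%N /\ (\sum_(l < m) (theta l : nat))%N = k,
          v 0%N = u0,
          (forall l, (l < m)%N ->
             if theta l then s l = grad f (v l)
             else 0 < gamma l /\
                  s l = (gamma l)^-1 *: (v l - prox g (gamma l) (v l))),
          (forall l, (1 <= l < m)%N -> in_span s l (v l - u0)) &
          in_span s m (A H f g u0 - u0)].

Definition risk (mu L : R) (A : method) : \bar R :=
  ereal_sup [set r : \bar R | exists (H : hilbertSpace R) (f g : H -> \bar R)
      (ustar u0 : H),
      [/\ Fclass mu L%:E f, Fclass 0 +oo%E g,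
          is_argmin (fun x => f x + g x)%E ustar, u0 != ustar &
          r = (`|A H f g u0 - ustar| ^+ 2 / `|u0 - ustar| ^+ 2)%:E]].

Fixpoint Aseq (q : R) (k : nat) : R :=
  match k with
  | 0%N => 0
  | k'.+1 => let a := Aseq q k' in
      ((1 + q) * a + 2 * (1 + Num.sqrt ((1 + a) * (1 + q * a)))) / (1 - q) ^+ 2
  end.

Section ProxITEM.
Variables (mu L : R) (H : hilbertSpace R) (f g : H -> \bar R).
Let q := mu / L.

Definition item_step (k : nat) (xz : H * H) : H * H :=
  let (x, z) := xz in
  let beta := Aseq q k / ((1 - q) * Aseq q k.+1) in
  let delta := Num.sqrt (Aseq q k.+1 / (1 + q * Aseq q k.+1)) in
  let y := (1 - beta) *: z + beta *: x in
  let zbar := (1 - q * delta) *: z + (q * delta) *: y - (delta / L) *: grad f y in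
  let z' := prox g (delta / L) zbar in
  let x' := y - L^-1 *: grad f y - delta^-1 *: (zbar - z') in
  (x', z').

Fixpoint item_iter (k : nat) (x0 : H) : H * H :=
  match k with
  | 0%N => (x0, x0)
  | k'.+1 => item_step k' (item_iter k' x0)
  end.
End ProxITEM.

Definition prox_item (mu L : R) (k : nat) : method :=
  fun H f g u0 => (item_iter mu L f g k u0).2.

End Defs.

(* Main.v *)
Require Import Defs.
From HB Require Import structures.
From mathcomp Require Import all_boot all_order all_algebra.
From mathcomp Require Import all_classical all_reals all_analysis.
From mathcomp Require Import ring lra.
Set Implicit Arguments. Unset Strict Implicit. Unset Printing Implicit Defensive.
Import Order.TTheory GRing.Theory Num.Theory.
Import numFieldNormedType.Exports.
Local Open Scope classical_set_scope.
Local Open Scope ring_scope.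

(**
Upper bound. Put L = 1, x* = 0 and tilt f and g so that both are minimized
at 0. With r = f'(y) - q y and w = y - f'(y), membership of f in F_{q,1} means
that U(w) = (1 - q) (f(y) - |f'(y)|^2 / 2) - q |w|^2 / 2 is convex with
subgradient r. If s is the subgradient of g produced at z, then
  A U + (1 + q A) |z|^2 + A/2 |s|^2 + q A <s, z>
does not increase along Prox-ITEM, because delta^2 (1 + q A') = A' and
2 delta (1 + q A') = (1 + q) A' - A.

Lower bound. Take g = 0, u0 = 0 and f = mu/2 |x|^2 + the Moreau envelope with
parameter 1/(L - mu) of a maximum of k + 1 affine functions with slopes
s_j = sum_(l < j) kap_l e_l + nu_j e_j, all vanishing at a common point. The
weights make f a zero chain: a gradient taken in span(e_0 .. e_(i-1)) lies in
span(e_0 .. e_i), so after k gradients the coordinate along e_k is still 0,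
whereas that of the minimizer -s_k/mu carries the fraction 1/(1 + q A_k) of its
squared norm.
*)

(** * Euclidean space as a Hilbert space *)

(** Row vectors already carry the sup norm; a type alias makes room for the Euclidean one. *)
Definition euclid (R : realType) (n : nat) : Type := 'rV[R]_n.

Section Euclid.
Variables (R : realType) (n : nat).

HB.instance Definition _ := GRing.Lmodule.copy (euclid R n) 'rV[R]_n.

Definition dot (u v : euclid R n) : R := \sum_i u 0 i * v 0 i.
Definition euclid_norm (u : euclid R n) : R := Num.sqrt (dot u u).

Lemma dotC u v : dot u v = dot v u.
Proof. by apply: eq_bigr => i _; rewrite mulrC. Qed.

Lemma dot_linl (a : R) (u v w : euclid R n) :
  dot (a *: u + v) w = a * dot u w + dot v w.
Proof.
rewrite /dot mulr_sumr -big_split/=; apply: eq_bigr => i _.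
by rewrite !mxE mulrDl mulrA.
Qed.

Lemma dot_ge0 u : 0 <= dot u u.
Proof. by apply: sumr_ge0 => i _; rewrite -expr2 sqr_ge0. Qed.

Lemma sqr_euclid_norm u : euclid_norm u ^+ 2 = dot u u.
Proof. by rewrite sqr_sqrtr// dot_ge0. Qed.

Lemma dotDl u v w : dot (u + v) w = dot u w + dot v w.
Proof. by rewrite -[u in LHS]scale1r dot_linl mul1r. Qed.

Lemma dotDr u v w : dot w (u + v) = dot w u + dot w v.
Proof. by rewrite dotC dotDl !(dotC w). Qed.

Lemma dot0l u : dot 0 u = 0.
Proof. by apply: big1 => i _; rewrite mxE mul0r. Qed.

Lemma dotZl a u v : dot (a *: u) v = a * dot u v.
Proof. by rewrite -[a *: u]addr0 dot_linl dot0l addr0. Qed.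

Lemma dotZr a u v : dot v (a *: u) = a * dot v u.
Proof. by rewrite dotC dotZl dotC. Qed.

Lemma dot_eq0 u : dot u u = 0 -> u = 0.
Proof.
move=> /eqP; rewrite /dot psumr_eq0; last by move=> i _; rewrite -expr2 sqr_ge0.
move=> /allP u0; apply/rowP => i; rewrite mxE; apply/eqP.
by have := u0 i (mem_index_enum i); rewrite -expr2 sqrf_eq0.
Qed.

(** Cauchy-Schwarz, from nonnegativity of the squared norm of [dot v v *: u - dot u v *: v]. *)
Lemma dot_le_norm u v : dot u v <= euclid_norm u * euclid_norm v.
Proof.
have [/dot_eq0 ->|v0] := eqVneq (dot v v) 0.
  by rewrite dotC dot0l mulr_ge0 ?sqrtr_ge0.
have vp : 0 < dot v v by rewrite lt_neqAle eq_sym v0 dot_ge0.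
have := dot_ge0 (dot v v *: u + - dot u v *: v).
rewrite !(dotDl, dotDr, dotZl, dotZr) (dotC v u) => h.
have h2 : dot u v ^+ 2 <= dot u u * dot v v.
  by rewrite -(ler_pM2l vp); move: h; lra.
rewrite /euclid_norm -sqrtrM ?dot_ge0//.
by apply: le_trans (ler_norm _) _; rewrite -sqrtr_sqr ler_wsqrtr.
Qed.

Lemma euclid_normD u v : euclid_norm (u + v) <= euclid_norm u + euclid_norm v.
Proof.
rewrite -ler_sqr ?nnegrE ?addr_ge0 ?sqrtr_ge0//.
rewrite sqr_euclid_norm sqrrD !sqr_euclid_norm dotDl !dotDr (dotC v u).
by have := dot_le_norm u v; rewrite mulr2n; lra.
Qed.

Lemma euclid_normZ (a : R) u : euclid_norm (a *: u) = `|a| * euclid_norm u.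
Proof.
by rewrite /euclid_norm dotZl dotZr mulrA -expr2 sqrtrM ?sqr_ge0// sqrtr_sqr.
Qed.

Lemma euclid_norm_eq0 u : euclid_norm u = 0 -> u = 0.
Proof.
by move=> u0; apply: dot_eq0; rewrite -sqr_euclid_norm u0 expr0n.
Qed.

HB.instance Definition _ := @Lmodule_isNormed.Build R (euclid R n)
  euclid_norm euclid_normD euclid_normZ euclid_norm_eq0.

Lemma euclid_norm_coord (u : euclid R n) i : `|u 0 i| <= `|u|.
Proof.
rewrite -sqrtr_sqr; apply: ler_wsqrtr.
rewrite /dot (bigD1 i)//= -expr2 lerDl; apply: sumr_ge0 => j _.
by rewrite -expr2 sqr_ge0.
Qed.

Lemma euclid_norm_sum (u : euclid R n) : `|u| <= \sum_i `|u 0 i|.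
Proof.
rewrite -(ger0_norm (sumr_ge0 _ _)); last by move=> *; exact: normr_ge0.
rewrite -sqrtr_sqr; apply: ler_wsqrtr.
rewrite expr2 mulr_suml; apply: ler_sum => i _.
rewrite -expr2 -real_normK ?num_real// expr2; apply: ler_wpM2l => //.
by rewrite (bigD1 i)//= lerDl; apply: sumr_ge0.
Qed.

(** Limits are taken coordinatewise; [euclid_norm_sum] turns small coordinate errors into a small
    norm. *)
Lemma euclid_complete (F : set_system (euclid R n)) :
  ProperFilter F -> cauchy F -> cvg F.
Proof.
move=> FF Fc; have Fb : cauchy_ball F by apply/cauchy_ballP.
have cvgF i : cvg ((fun u : euclid R n => u 0 i : R) @ F).
  apply: R_complete; apply/cauchy_ballP => e e0.
  rewrite near_map2; apply: filterS (Fb e e0) => -[u v]/=.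
  rewrite -!ball_normE /ball_/=; apply: le_lt_trans.
  by have := euclid_norm_coord (u - v) i; rewrite !mxE.
pose l : euclid R n := \row_i lim ((fun u : euclid R n => u 0 i : R) @ F).
apply/cvg_ex; exists l; apply/cvgrPdist_le => /= e e0.
have n0 : 0 < n.+1%:R :> R by rewrite ltr0n.
have e1 : 0 < e / n.+1%:R by rewrite divr_gt0.
have Fi : \forall u \near F, forall i,
    `|l 0 i - (u : euclid R n) 0 i| <= e / n.+1%:R.
  apply: filter_forall => i; rewrite mxE.
  by have /cvgrPdist_le /(_ _ e1) := cvgF i.
near=> u; apply: (le_trans (euclid_norm_sum _)).
have ui : forall i, `|l 0 i - u 0 i| <= e / n.+1%:R by near: u.
apply: (@le_trans _ _ (\sum_(i < n) e / n.+1%:R)).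
  by apply: ler_sum => i _; have := ui i; rewrite !mxE.
rewrite sumr_const card_ord -[_ *+ n]mulr_natr -mulrA ler_piMr ?(ltW e0)//.
by rewrite mulrC ler_pdivrMr// mul1r ler_nat.
Unshelve. all: by end_near. Qed.

HB.instance Definition _ :=
  Uniform_isComplete.Build (euclid R n) euclid_complete.

Definition euclid_space : hilbertSpace R :=
  @HilbertSpace R (euclid R n) dot dotC dot_linl sqr_euclid_norm.

End Euclid.

(** * Smooth strongly convex functions *)

Section Inner.
Variables (R : realType) (H : hilbertSpace R).
Implicit Types (x y z s d : H) (a : R).
Local Notation "⟪ x , y ⟫" := (hinner x y).

Lemma inner0l x : ⟪0, x⟫ = 0.
Proof. by have := hinner_linl 1 0 0 x; rewrite scale1r addr0 mul1r; lra. Qed.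

Lemma innerDl x y z : ⟪x + y, z⟫ = ⟪x, z⟫ + ⟪y, z⟫.
Proof. by have := hinner_linl 1 x y z; rewrite scale1r mul1r. Qed.

Lemma innerZl a x y : ⟪a *: x, y⟫ = a * ⟪x, y⟫.
Proof. by have := hinner_linl a x 0 y; rewrite inner0l !addr0. Qed.

Lemma innerNl x y : ⟪- x, y⟫ = - ⟪x, y⟫.
Proof. by rewrite -scaleN1r innerZl mulN1r. Qed.

Lemma inner0r x : ⟪x, 0⟫ = 0.
Proof. by rewrite hinner_sym inner0l. Qed.

Lemma innerDr x y z : ⟪z, x + y⟫ = ⟪z, x⟫ + ⟪z, y⟫.
Proof. by rewrite hinner_sym innerDl !(hinner_sym _ z). Qed.

Lemma innerZr a x y : ⟪y, a *: x⟫ = a * ⟪y, x⟫.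
Proof. by rewrite hinner_sym innerZl hinner_sym. Qed.

Lemma innerNr x y : ⟪y, - x⟫ = - ⟪y, x⟫.
Proof. by rewrite hinner_sym innerNl hinner_sym. Qed.

Lemma inner_ge0 x : 0 <= ⟪x, x⟫.
Proof. by rewrite -hnorm_inner sqr_ge0. Qed.

Lemma inner_eq0 x : ⟪x, x⟫ <= 0 -> x = 0.
Proof.
move=> x0; apply/eqP; rewrite -normr_eq0 -sqrf_eq0 hnorm_inner.
by rewrite eq_le x0 inner_ge0.
Qed.

Lemma inner_sumr (I : Type) (r : seq I) (P : pred I) (u : I -> H) x :
  ⟪x, \sum_(i <- r | P i) u i⟫ = \sum_(i <- r | P i) ⟪x, u i⟫.
Proof.
by elim/big_rec2: _ => [|i a y _ <-]; rewrite ?inner0r ?innerDr.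
Qed.

Definition innerE :=
  (innerDl, innerDr, innerNl, innerNr, innerZl, innerZr, inner0l, inner0r).

Lemma inner_le_norm x y : ⟪x, y⟫ <= `|x| * `|y|.
Proof.
have [->|y0] := eqVneq y 0; first by rewrite inner0r mulr_ge0.
have yp : 0 < ⟪y, y⟫ by rewrite -hnorm_inner exprn_gt0// normr_gt0.
have := inner_ge0 (⟪y, y⟫ *: x - ⟪x, y⟫ *: y).
rewrite !innerE (hinner_sym y x) => h.
have h2 : ⟪x, y⟫ ^+ 2 <= (`|x| * `|y|) ^+ 2.
  by rewrite exprMn !hnorm_inner -(ler_pM2l yp); move: h; lra.
apply: (le_trans (ler_norm _)).
by rewrite -(@ler_pXn2r _ 2)// ?nnegrE ?mulr_ge0// real_normK ?num_real.
Qed.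

(** Turns vector identities into scalar ones, which [ring] and [field] can settle. *)
Lemma inner_inj x y : (forall t : H, ⟪t, x⟫ = ⟪t, y⟫) -> x = y.
Proof.
move=> h; apply/eqP; rewrite -subr_eq0; apply/eqP/inner_eq0.
by rewrite innerDr innerNr h subrr.
Qed.

End Inner.

(** Stands in for the limit [e -> 0+]; the bound [e < 1] lets [e] also serve as a convex weight. *)
Lemma le_of_add_small (R : realType) (a b c : R) :
  (forall e, 0 < e -> e < 1 -> a <= b + e * c) -> a <= b.
Proof.
move=> h; rewrite leNgt; apply/negP => ab.
(* With this choice [e * c] is at most half of the gap [a - b]. *)
pose e := Num.min 2^-1 ((a - b) / (2 * (`|c| + 1))).
have c1 : 0 < 2 * (`|c| + 1) by have := normr_ge0 c; lra.
have e0 : 0 < e by rewrite lt_min divr_gt0 ?subr_gt0// invr_gt0 ltr0n.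
have e1 : e < 1 by rewrite gt_min; apply/orP; left; lra.
have := h e e0 e1.
have : e * (2 * (`|c| + 1)) <= a - b.
  by rewrite -ler_pdivlMr// ge_min lexx orbT.
have : e * c <= e * `|c| by rewrite ler_pM2l// ler_norm.
by have := normr_ge0 c; nra.
Qed.

(** * Gradients and first-order bounds *)

Section Smooth.
Variables (R : realType) (H : hilbertSpace R).
Implicit Types (f : H -> \bar R) (x y z s d : H) (a : R).
Local Notation "⟪ x , y ⟫" := (hinner x y).

(** Along a short multiple of [s - t] the two expansions give [|s - t|^2 <= 2 e |s - t|] for all
    small [e]. *)
Lemma frechet_grad_unique f x s t :
  frechet_grad f x s -> frechet_grad f x t -> s = t.
Proof.
move=> [_ fs] [_ ft]; apply/eqP; rewrite -subr_eq0; apply/eqP/inner_eq0.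
set d := s - t; apply: (@le_of_add_small _ _ _ (2 * `|d|)) => e e0 _.
have [u u0 {}fs] := fs e e0; have [v v0 {}ft] := ft e e0.
have [->|dn0] := eqVneq d 0; first by rewrite inner0l normr0 !mulr0 addr0.
have dp : 0 < `|d| by rewrite normr_gt0.
pose a := Num.min u v / (2 * `|d|).
have m0 : 0 < Num.min u v by rewrite lt_min u0 v0.
have a0 : 0 < a by rewrite divr_gt0// mulr_gt0.
have ad : `|a *: d| < Num.min u v.
  have : a * (2 * `|d|) = Num.min u v by rewrite divfK// mulf_neq0 ?gt_eqF.
  by rewrite normrZ gtr0_norm//; move: m0; lra.
have [adu adv] : `|a *: d| < u /\ `|a *: d| < v.
  by move: ad; rewrite lt_min => /andP[].
have [_ {}fs] := fs _ adu; have [_ {}ft] := ft _ adv.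
move: fs ft; rewrite !ler_norml => /andP[h1 _] /andP[_ h2].
have h : a * ⟪d, d⟫ <= a * (e * (2 * `|d|)).
  have -> : ⟪d, d⟫ = ⟪s, d⟫ - ⟪t, d⟫ by rewrite {1}/d innerDl innerNl.
  by move: h1 h2; rewrite normrZ gtr0_norm// !innerZr; lra.
by rewrite add0r -(ler_pM2l a0).
Qed.

Lemma grad_eq f x s : frechet_grad f x s -> grad f x = s.
Proof.
move=> fs; rewrite /grad; case: xgetP => [t _ ft|/(_ s)//].
exact: frechet_grad_unique ft fs.
Qed.

(** Strong convexity on the segment from [x] to [y], divided by [t] and compared with the Frechet
    expansion at [x] as [t -> 0]. *)
Lemma grad_lower_bound (mu : R) f x s y : 0 <= mu -> strongly_convex mu f ->
  (forall z, f z \is a fin_num) -> frechet_grad f x s ->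
  fine (f x) + ⟪s, y - x⟫ + mu / 2 * `|y - x| ^+ 2 <= fine (f y).
Proof.
move=> mu0 scf finf [_ fs]; set d := y - x.
apply: (@le_of_add_small _ _ _ (mu / 2 * `|d| ^+ 2 + `|d|)) => e e0 e1.
have [u u0 {}fs] := fs e e0.
have d1 : 0 < `|d| + 1 by have := normr_ge0 d; lra.
(* Ensures [t <= e], so that the quadratic correction is small, and [t |d| < u], so that the
   expansion applies; the [+ 1] avoids a division by zero. *)
pose t := Num.min e (u / (`|d| + 1)) / 2.
have m0 : 0 < Num.min e (u / (`|d| + 1)) by rewrite lt_min e0 divr_gt0.
have t0 : 0 < t by rewrite divr_gt0.
have te : t <= e.
  have : Num.min e (u / (`|d| + 1)) <= e by rewrite ge_min lexx.
  by rewrite /t; lra.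
have td : `|t *: d| < u.
  have : 2 * t * (`|d| + 1) <= u.
    by rewrite -ler_pdivlMr// /t mulrCA divff ?mulr1 ?ge_min ?lexx ?orbT//
      pnatr_eq0.
  by rewrite normrZ gtr0_norm//; have := normr_ge0 d; nra.
have [_ {}fs] := fs (t *: d) td.
have t01 : 0 < t < 1 by rewrite t0 (le_lt_trans te).
have := scf y x t t01.
have -> : t *: y + (1 - t) *: x = x + t *: d.
  by rewrite /d scalerBr scalerBl scale1r addrCA.
rewrite -(fineK (finf y)) -(fineK (finf x)) -(fineK (finf (x + _))).
rewrite -!EFinM -EFinD lee_fin -/d => hc.
move: fs; rewrite normrZ gtr0_norm// innerZr ler_norml => /andP[h1 _].
have h : t * (fine (f x) + ⟪s, d⟫ + mu / 2 * `|d| ^+ 2) <=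
    t * (fine (f y) + (t * (mu / 2 * `|d| ^+ 2) + e * `|d|)).
  by move: h1 hc; lra.
move: h; rewrite ler_pM2l//.
have : t * (mu / 2 * `|d| ^+ 2) <= e * (mu / 2 * `|d| ^+ 2).
  by apply: ler_wpM2r => //; rewrite mulr_ge0 ?sqr_ge0//; lra.
by lra.
Qed.

(** * Descent and interpolation inequalities *)

Section Interpolation.
Variables (mu L : R) (f : H -> \bar R).
Hypotheses (mu0 : 0 <= mu) (ff : Fclass mu L%:E f).
Local Notation F x := (fine (f x)).
Local Notation G := (grad f).

Lemma Fclass_frechet x : frechet_grad f x (G x).
Proof.
have [_ _ _ /(_ L erefl)[g [gf _]]] := ff.
by rewrite (grad_eq (gf x)).
Qed.

Lemma Fclass_fin x : f x \is a fin_num.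
Proof. by have [] := Fclass_frechet x. Qed.

Lemma Fclass_lipschitz x y : `|G x - G y| <= L * `|x - y|.
Proof.
have [_ _ _ /(_ L erefl)[g [gf gl]]] := ff.
by rewrite !(grad_eq (gf _)).
Qed.

Lemma Fclass_lower x y :
  F x + ⟪G x, y - x⟫ + mu / 2 * `|y - x| ^+ 2 <= F y.
Proof.
have [_ _ scf _] := ff.
exact: grad_lower_bound mu0 scf Fclass_fin (Fclass_frechet x).
Qed.

(* Riemann sum of the gradient along the segment [x, x + d]. *)
Lemma Fclass_partial_descent x d n i : (i <= n.+1)%N ->
  F (x + (i%:R / n.+1%:R) *: d) <= F x + i%:R / n.+1%:R * ⟪G x, d⟫ +
    L * `|d| ^+ 2 * (i%:R * (i%:R + 1)) / (2 * n.+1%:R ^+ 2).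
Proof.
have n0 : 0 < n.+1%:R :> R by rewrite ltr0n.
elim: i => [_|i IH ik].
  by rewrite !mul0r scale0r !addr0 mulr0 mul0r addr0.
have {}IH := IH (ltnW ik).
set N := n.+1%:R; set t : R := i%:R / N; set u := i.+1%:R / N.
have uE : u = t + N^-1 by rewrite /u /t -natr1 mulrDl mul1r.
have u0 : 0 <= u by rewrite divr_ge0// ltW.
(* Convexity based at the farther node bounds the increment by the gradient there, which the
   Lipschitz bound compares with [G x]. *)
have := Fclass_lower (x + u *: d) (x + t *: d).
have -> : x + t *: d - (x + u *: d) = - N^-1 *: d.
  by rewrite uE opprD addrACA subrr add0r -scalerBl opprD addrA subrr add0r.
have : 0 <= mu / 2 * `|- N^-1 *: d| ^+ 2 by rewrite mulr_ge0 ?divr_ge0 ?sqr_ge0.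
have h : ⟪G (x + u *: d) - G x, d⟫ <= u * L * `|d| ^+ 2.
  apply: (le_trans (inner_le_norm _ _)).
  rewrite expr2 mulrA; apply: ler_wpM2r => //.
  apply: (le_trans (Fclass_lipschitz _ _)).
  by rewrite addrAC subrr add0r normrZ ger0_norm// mulrCA mulrA.
rewrite innerZr => h1 h2.
have h3 : N^-1 * ⟪G (x + u *: d), d⟫ <= N^-1 * (⟪G x, d⟫ + u * L * `|d| ^+ 2).
  rewrite ler_pM2l ?invr_gt0//; move: h; rewrite innerDl innerNl; lra.
rewrite -/N -/t in IH.
have -> : F x + u * ⟪G x, d⟫ +
    L * `|d| ^+ 2 * (i.+1%:R * (i.+1%:R + 1)) / (2 * N ^+ 2) =
  F x + t * ⟪G x, d⟫ + L * `|d| ^+ 2 * (i%:R * (i%:R + 1)) / (2 * N ^+ 2) +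
    N^-1 * (⟪G x, d⟫ + u * L * `|d| ^+ 2).
  by rewrite uE /t -natr1; field; rewrite gt_eqF.
by move: IH h1 h2 h3; clearbody N t u; lra.
Qed.

(** At [i = n.+1] the partial sums carry the factor [1 + 1/(n+1)] on the quadratic term; then [n]
    tends to infinity. *)
Lemma Fclass_descent x y :
  F y <= F x + ⟪G x, y - x⟫ + L / 2 * `|y - x| ^+ 2.
Proof.
set d := y - x; set C := L / 2 * `|d| ^+ 2.
apply: (@le_of_add_small _ _ _ `|C|) => e e0 _.
have [n] := ltr_add_invr e0; rewrite add0r => ne.
have n0 : n.+1%:R != 0 :> R by rewrite pnatr_eq0.
have := @Fclass_partial_descent x d n n.+1 (leqnn _).
rewrite divff// scale1r addrC subrK mul1r => /le_trans; apply.
have -> : L * `|d| ^+ 2 * (n.+1%:R * (n.+1%:R + 1)) / (2 * n.+1%:R ^+ 2) =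
    C + n.+1%:R^-1 * C by rewrite /C; field.
rewrite addrA lerD2l; apply: (@le_trans _ _ (n.+1%:R^-1 * `|C|)).
  by rewrite ler_wpM2l ?ler_norm// invr_ge0.
by apply: ler_wpM2r => //; exact: ltW.
Qed.

Hypothesis muL : mu < L.

Let p x := G x - mu *: x.

(** The cocoercivity inequality of [F - mu/2 |.|^2], obtained by squeezing [F] at one point between
    the lower bound from [x] and the upper bound from [y]. *)
Lemma Fclass_interpolation x y :
  F x - mu / 2 * `|x| ^+ 2 + ⟪p x, y - x⟫ +
    (2 * (L - mu))^-1 * `|p x - p y| ^+ 2 <= F y - mu / 2 * `|y| ^+ 2.
Proof.
pose c := (L - mu)^-1; have c0 : 0 < c by rewrite invr_gt0 subr_gt0.
have cE : L = mu + c^-1 by rewrite invrK; lra.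
(* The minimizer of the upper bound from [y] minus the lower bound from [x]. *)
pose z := y - c *: (p y - p x).
have := Fclass_lower x z; have := Fclass_descent y z.
have -> : (2 * (L - mu))^-1 = c / 2 by rewrite invfM mulrC.
rewrite !hnorm_inner cE /z /p !innerE.
rewrite (hinner_sym y x) (hinner_sym (G y) (G x)) (hinner_sym y (G y)).
rewrite (hinner_sym y (G x)) (hinner_sym x (G y)) (hinner_sym x (G x)).
move=> h1 h2; have := lerD h1 h2; rewrite -subr_ge0 => h.
rewrite -subr_ge0; move: h; congr (0 <= _); field.
by rewrite gt_eqF.
Qed.

End Interpolation.
End Smooth.

(** * Proximal points *)

Section Prox.
Variables (R : realType) (H : hilbertSpace R).
Implicit Types (x y z w s : H) (r v t : R).
Local Notation "⟪ x , y ⟫" := (hinner x y).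

(** The value [v] records that [g z] is finite; testing against epigraph points [(w, r)] keeps the
    inequality in the reals. *)
Definition is_subgrad (g : H -> \bar R) z s v : Prop :=
  g z = v%:E /\ forall w r, (g w <= r%:E)%E -> v + ⟪s, w - z⟫ <= r.

Variable g : H -> \bar R.
Hypothesis gg : Fclass 0 +oo%E g.

Lemma epigraph_convex x y r v t : 0 < t < 1 ->
  (g x <= r%:E)%E -> (g y <= v%:E)%E ->
  (g (t *: x + (1 - t) *: y)%R <= (t * r + (1 - t) * v)%:E)%E.
Proof.
move=> t01 xr yv; have [_ _ scg _] := gg.
apply: (le_trans (scg x y t t01)).
rewrite !mul0r sube0 [leRHS]EFinD !EFinM; have /andP[t0 t1] := t01.
by apply: leeD; apply: lee_wpmul2l => //; rewrite lee_fin; lra.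
Qed.

Lemma Fclass_dom : exists x r, g x = r%:E.
Proof.
have [[[x gx] gn] _ _ _] := gg; exists x, (fine (g x)).
by rewrite fineK// fin_numE gn gx.
Qed.

(** Lower semicontinuity keeps [g] above [r0 - 1] on a ball around [x0]; convexity along the segment
    to a farther [y] carries this outwards at a linear rate. *)
Lemma Fclass_affine_minorant : exists x0 (c K : R), 0 <= K /\
  forall y r, (g y <= r%:E)%E -> c - K * `|y - x0| <= r.
Proof.
have [x0 [r0 gx0]] := Fclass_dom; have [_ lscg _ _] := gg.
have [|d d0 hd] := lscg x0 (r0 - 1); first by rewrite gx0 lte_fin; lra.
exists x0, (r0 - 1), (2 / d); split; first by rewrite divr_ge0// ltW.
move=> y r yr.
have [yd|yd] := ltP `|y - x0| d.
  have := lt_le_trans (hd y yd) yr; rewrite lte_fin => h.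
  have : 0 <= 2 / d * `|y - x0| by rewrite mulr_ge0// divr_ge0// ltW.
  by lra.
set D := `|y - x0| in yd *; have D0 : 0 < D by exact: lt_le_trans yd.
(* Puts [x0 + t (y - x0)] at distance [d / 2] from [x0], inside the ball. *)
pose t := d / (2 * D).
have tD : t * (2 * D) = d by rewrite divfK// mulf_neq0 ?gt_eqF.
have t0 : 0 < t by rewrite divr_gt0// mulr_gt0.
have t1 : t < 1 by rewrite ltr_pdivrMr ?mulr_gt0//; lra.
have t01 : 0 < t < 1 by rewrite t0.
have gx0' : (g x0 <= r0%:E)%E by rewrite gx0.
have := epigraph_convex t01 yr gx0'.
have -> : t *: y + (1 - t) *: x0 = x0 + t *: (y - x0).
  by rewrite scalerBr scalerBl scale1r addrCA.
have xd : `|x0 + t *: (y - x0) - x0| < d.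
  by rewrite addrAC subrr add0r normrZ gtr0_norm// -/D; lra.
move=> /(lt_le_trans (hd _ xd)); rewrite lte_fin => h.
have E : t * (2 / d * D) = 1.
  by rewrite /t; field; rewrite ?gt_eqF.
by rewrite -(ler_pM2l t0) mulrBr E; lra.
Qed.

(** A real [w] strictly between [v] and [g z] would be exceeded by [g] near [z], yet not along the
    sequence. *)
Lemma epigraph_closed (u : nat -> H) (r : nat -> R) z v :
  u @ \oo --> z -> r @ \oo --> v -> (forall n, (g (u n) <= (r n)%:E)%E) ->
  (g z <= v%:E)%E.
Proof.
move=> uz rv gur; have [_ lscg _ _] := gg.
rewrite leNgt; apply/negP => gz.
have [w vw wz] : exists2 w, v < w & (w%:E < g z)%E.
  move: gz; case: (g z) => [a| |]//; last first.
    by exists (v + 1); [rewrite ltrDl|rewrite ltry].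
  by rewrite lte_fin => va; exists ((v + a) / 2); rewrite ?lte_fin; lra.
have [d d0 hd] := lscg z w wz.
have wv0 : 0 < w - v by rewrite subr_gt0.
near \oo => n.
have un : `|u n - z| < d by near: n; move/cvgrPdistC_lt : uz => /(_ _ d0).
have := lt_le_trans (hd _ un) (gur n); rewrite lte_fin.
have : `|r n - v| < w - v by near: n; move/cvgrPdistC_lt : rv => /(_ _ wv0).
by rewrite ltr_norml => /andP[_]; lra.
Unshelve. all: by end_near. Qed.

(** * Existence of the proximal point *)

Section Existence.
Variables (gamma : R) (x : H).
Hypothesis gamma0 : 0 < gamma.
Let c := 1 / (2 * gamma).

Let c0 : 0 < c. Proof. by rewrite divr_gt0// mulr_gt0. Qed.

(** Objective values over epigraph points, so that the infimum is one of real numbers. *)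
Let S : set R := [set v | exists z r, (g z <= r%:E)%E /\
  v = r + c * `|x - z| ^+ 2].

Let S_has_inf : has_inf S.
Proof.
split.
  have [z [r gz]] := Fclass_dom; exists (r + c * `|x - z| ^+ 2); exists z, r.
  by rewrite gz.
have [x0 [a [K [K0 hK]]]] := Fclass_affine_minorant.
(* The minorant loses at most [K (|x - z| + |x - x0|)]; completing the square against [c |x - z|^2]
   leaves [K^2 / (4 c)]. *)
exists (a - K * `|x - x0| - K ^+ 2 / (4 * c)) => _ [z [r [gz ->]]].
have h1 := hK z r gz.
have : `|z - x0| <= `|x - z| + `|x - x0|.
  by rewrite (distrC x z); have := ler_distD x z x0; lra.
move=> /(ler_wpM2l K0) h2.
have : 0 <= (2 * c * `|x - z| - K) ^+ 2 / (4 * c).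
  by rewrite divr_ge0 ?sqr_ge0// mulr_ge0// ltW.
have -> : (2 * c * `|x - z| - K) ^+ 2 / (4 * c) =
   c * `|x - z| ^+ 2 - K * `|x - z| + K ^+ 2 / (4 * c).
  by field; rewrite gt_eqF.
by lra.
Qed.

(* Strong convexity of the prox objective makes minimizing sequences Cauchy. *)
Let near_min z w r v e :
  (g z <= r%:E)%E -> (g w <= v%:E)%E ->
  r + c * `|x - z| ^+ 2 <= inf S + e -> v + c * `|x - w| ^+ 2 <= inf S + e ->
  c * `|z - w| ^+ 2 <= 4 * e.
Proof.
move=> gz gw hz hw.
have t01 : 0 < (2^-1 : R) < 1 by apply/andP; split; lra.
have := epigraph_convex t01 gz gw => gm.
have := ge_inf (proj2 S_has_inf) (_ : S (2^-1 * r + (1 - 2^-1) * v +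
  c * `|x - (2^-1 *: z + (1 - 2^-1) *: w)| ^+ 2)).
move=> /(_ (ex_intro _ _ (ex_intro _ _ (conj gm erefl)))).
move: hz hw; rewrite !hnorm_inner !innerE.
rewrite (hinner_sym z x) (hinner_sym w x) (hinner_sym w z).
by move: (inf S) (c) => m a; lra.
Qed.

(** Direct method: a minimizing sequence is Cauchy by [near_min], and its limit is a minimizer
    because the epigraph is closed. *)
Lemma prox_exists : exists z, is_prox g gamma x z.
Proof.
have hn (n : nat) : exists zr : H * R, (g zr.1 <= zr.2%:E)%E /\
    zr.2 + c * `|x - zr.1| ^+ 2 <= inf S + n.+1%:R^-1.
  have n0 : 0 < n.+1%:R^-1 :> R by rewrite invr_gt0 ltr0n.
  have [_ [z [r [gz ->]]] h] := inf_adherent n0 S_has_inf.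
  by exists (z, r); split => //; exact: ltW.
have [u hu] := choice hn.
have Cu : cauchy ((fun n => (u n).1) @ \oo).
  apply/cauchy_ballP => e e0; rewrite near_map2.
  have e1 : 0 < c * e ^+ 2 / 4 by rewrite !(divr_gt0, mulr_gt0, exprn_gt0).
  have [N _ hN] := near_infty_natSinv_lt (PosNum e1).
  exists ([set n | (N <= n)%N], [set n | (N <= n)%N]) => /=.
    by split; exists N.
  move=> [n m] /= [Nn Nm]; rewrite -ball_normE /ball_ /=.
  have [gn hn'] := hu n; have [gm hm'] := hu m.
  pose e' := Num.max (n.+1%:R^-1) (m.+1%:R^-1 : R).
  have : e' < c * e ^+ 2 / 4.
    by rewrite gt_max; apply/andP; split; apply: hN.
  have := @near_min _ _ _ _ e' gn gm.
  move=> h he; rewrite ltNge; apply/negP => hle.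
  have : c * e ^+ 2 <= c * `|(u n).1 - (u m).1| ^+ 2.
    by rewrite ler_pM2l// lerXn2r ?nnegrE// ltW.
  have : c * `|(u n).1 - (u m).1| ^+ 2 <= 4 * e'.
    apply: h; [apply: (le_trans hn')|apply: (le_trans hm')];
    by rewrite lerD2l le_max lexx ?orbT.
  by lra.
have /cvg_ex[z uz] : cvg ((fun n => (u n).1) @ \oo) by exact: cauchy_cvg.
exists z => w.
have gz : (g z <= (inf S - c * `|x - z| ^+ 2)%:E)%E.
  apply: (@epigraph_closed (fun n => (u n).1)
    (fun n => inf S + n.+1%:R^-1 - c * `|x - (u n).1| ^+ 2)) => //; last first.
    move=> n; have [gn hn'] := hu n; apply: (le_trans gn).
    by rewrite lee_fin lerBrDr.
  apply: cvgB.
    rewrite -[X in _ --> X]addr0; apply: cvgD; first exact: cvg_cst.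
    exact: cvg_harmonic.
  apply: cvgM; first exact: cvg_cst.
  apply: (continuous_cvg _ (@exprn_continuous R 2 _)).
  by apply: cvg_norm; apply: cvgB => //; exact: cvg_cst.
have [[_ gn] _ _ _] := gg.
have [gw|gw] := eqVneq (g w) +oo%E; first by rewrite gw addye// leey.
have gwf : g w \is a fin_num by rewrite fin_numE gn.
apply: (@le_trans _ _ (inf S)%:E).
  rewrite -/c -[inf S](subrK (c * `|x - z| ^+ 2)) EFinD.
  exact: leeD.
rewrite -(fineK gwf) -EFinD lee_fin -/c; apply: ge_inf.
  exact: (proj2 S_has_inf).
by exists w, (fine (g w)); rewrite fineK.
Qed.

End Existence.

(** Minimality of [z] against [t w + (1 - t) z], divided by [t], leaves an error
    [t |w - z|^2 / (2 gamma)] that vanishes with [t]. *)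
Lemma is_prox_subgrad gamma x z : 0 < gamma -> is_prox g gamma x z ->
  is_subgrad g z (gamma^-1 *: (x - z)) (fine (g z)).
Proof.
move=> gamma0 pz; have [[[x1 gx1] gn] _ _ _] := gg.
have gzf : g z \is a fin_num.
  rewrite fin_numE gn /=; apply/eqP => gz.
  have := pz x1; rewrite gz addye// leye_eq => /eqP.
  by move: gx1 (gn x1); case: (g x1).
split=> [|w r gw]; first by rewrite fineK.
apply: (@le_of_add_small _ _ _ (1 / (2 * gamma) * `|w - z| ^+ 2)) => t t0 t1.
have t01 : 0 < t < 1 by rewrite t0.
have gz : (g z <= (fine (g z))%:E)%E by rewrite fineK.
have := le_trans (pz _) (leeD2r _ (epigraph_convex t01 gw gz)).
rewrite -{1}(fineK gzf) -!EFinD lee_fin.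
set v := fine _; rewrite -subr_ge0 => h.
rewrite -(ler_pM2l t0) -subr_ge0; move: h; congr (0 <= _).
rewrite !hnorm_inner !innerE.
rewrite (hinner_sym z x) (hinner_sym w x) (hinner_sym w z); field.
by rewrite gt_eqF.
Qed.

Lemma prox_subgrad gamma x : 0 < gamma ->
  is_subgrad g (prox g gamma x) (gamma^-1 *: (x - prox g gamma x))
    (fine (g (prox g gamma x))).
Proof.
move=> gamma0; apply: is_prox_subgrad => //; rewrite /prox.
case: xgetP => [//|/=]; have [z pz] := prox_exists x gamma0.
by move=> /(_ z).
Qed.

(** First-order optimality: on a short segment from [u] towards [w], [g] is bounded by convexity and
    [f] by its expansion at [u]. *)
Lemma argmin_subgrad mu L f u : 0 <= mu -> Fclass mu L%:E f ->
  is_argmin (fun x => f x + g x)%E u ->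
  is_subgrad g u (- grad f u) (fine (g u)).
Proof.
move=> mu0 ff au; have [x1 [r1 gx1]] := Fclass_dom.
have finf := Fclass_fin ff; have [[_ gn] _ _ _] := gg.
have guf : g u \is a fin_num.
  rewrite fin_numE gn /=; apply/eqP => gu.
  have := au x1; rewrite gu gx1 -(fineK (finf u)) -(fineK (finf x1)).
  by rewrite addey.
split=> [|w r gw]; first by rewrite fineK.
set d := w - u.
apply: (@le_of_add_small _ _ _ `|d|) => e e0 e1.
have [_ /(_ e e0)[a a0 fu]] := Fclass_frechet ff u.
have d1 : 0 < `|d| + 1 by have := normr_ge0 d; lra.
pose t := Num.min 2^-1 (a / (2 * (`|d| + 1))).
have t0 : 0 < t by rewrite lt_min divr_gt0 ?mulr_gt0// invr_gt0 ltr0n.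
have t1 : t < 1 by rewrite gt_min; apply/orP; left; lra.
have ta : t * (2 * (`|d| + 1)) <= a.
  by rewrite -ler_pdivlMr ?mulr_gt0// ge_min lexx orbT.
have t01 : 0 < t < 1 by rewrite t0.
have td : `|t *: d| < a.
  by rewrite normrZ gtr0_norm//; have := normr_ge0 d; nra.
have [_] := fu _ td; rewrite normrZ gtr0_norm// innerZr ler_norml => /andP[_ h1].
have gu : (g u <= (fine (g u))%:E)%E by rewrite fineK.
have := epigraph_convex t01 gw gu.
have -> : t *: w + (1 - t) *: u = u + t *: d.
  by rewrite scalerBr scalerBl scale1r addrCA.
move=> h2; have := le_trans (au _) (leeD2l _ h2).
rewrite /= -{1}(fineK guf) -(fineK (finf u)) -(fineK (finf (u + _))).
rewrite -!EFinD lee_fin => h3.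
rewrite innerNl -(ler_pM2l t0); move: h1 h3; lra.
Qed.

End Prox.

(** * Convergence of Prox-ITEM *)

Section Scalars.
Variables (R : realType) (q : R).
Hypotheses (q0 : 0 < q) (q1 : q < 1).
Local Notation A := (Aseq q).

Definition item_delta k : R := Num.sqrt (A k.+1 / (1 + q * A k.+1)).
Local Notation delta := item_delta.

Let q1sq : 0 < (1 - q) ^+ 2. Proof. by rewrite exprn_gt0// subr_gt0. Qed.

Lemma Aseq_succ k : (1 - q) ^+ 2 * A k.+1 =
  (1 + q) * A k + 2 * (1 + Num.sqrt ((1 + A k) * (1 + q * A k))).
Proof. by rewrite /= mulrCA divff ?mulr1// gt_eqF. Qed.

Lemma Aseq_ge0 k : 0 <= A k.
Proof.
elim: k => [//|k IH]; rewrite -(ler_pM2l q1sq) mulr0 Aseq_succ.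
by rewrite addr_ge0 ?mulr_ge0 ?addr_ge0 ?sqrtr_ge0// ltW.
Qed.

(** Clearing the square root in the recursion: [A k.+1] is the larger root of this quadratic. *)
Lemma Aseq_quadratic k : ((1 + q) * A k.+1 - A k) ^+ 2 =
  4 * A k.+1 * (1 + q * A k.+1).
Proof.
set s := Num.sqrt ((1 + A k) * (1 + q * A k)).
have s2 : s ^+ 2 = (1 + A k) * (1 + q * A k).
  by rewrite sqr_sqrtr// mulr_ge0// addr_ge0// ?mulr_ge0 ?Aseq_ge0// ltW.
have := Aseq_succ k; rewrite -/s.
move: (A k.+1) (A k) s s2 => b a s s2 h.
have E : (1 - q) ^+ 2 * (((1 + q) * b - a) ^+ 2 - 4 * b * (1 + q * b)) =
   ((1 - q) ^+ 2 * b) ^+ 2 - 2 * ((1 + q) * a + 2) * ((1 - q) ^+ 2 * b) +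
   (1 - q) ^+ 2 * a ^+ 2 by ring.
suff : (1 - q) ^+ 2 * (((1 + q) * b - a) ^+ 2 - 4 * b * (1 + q * b)) == 0.
  by rewrite mulf_eq0 gt_eqF//= subr_eq0 => /eqP.
rewrite E h.
have -> : ((1 + q) * a + 2 * (1 + s)) ^+ 2 -
  2 * ((1 + q) * a + 2) * ((1 + q) * a + 2 * (1 + s)) +
  (1 - q) ^+ 2 * a ^+ 2 = 4 * (s ^+ 2 - (1 + a) * (1 + q * a)) by ring.
by rewrite s2 subrr mulr0 eqxx.
Qed.

Lemma Aseq_le_succ k : A k <= A k.+1.
Proof.
rewrite -(ler_pM2l q1sq) Aseq_succ.
have := Aseq_ge0 k; have := sqrtr_ge0 ((1 + A k) * (1 + q * A k)).
move: (Num.sqrt ((1 + A k) * (1 + q * A k))) (A k) => s a s0 a0.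
have : 0 <= a * (q * (3 - q)) by rewrite !mulr_ge0//; move: q0 q1; lra.
by lra.
Qed.

(** Read as [1 + q * A k.+1 < A k.+1], this is what gives [delta k > 1]. *)
Lemma Aseq_succ_gt k : 1 < (1 - q) * A k.+1.
Proof.
have p0 : 0 < 1 - q by rewrite subr_gt0.
rewrite -(ltr_pM2l p0) mulr1 mulrA -expr2 Aseq_succ.
have := Aseq_ge0 k; have := sqrtr_ge0 ((1 + A k) * (1 + q * A k)).
move: (Num.sqrt ((1 + A k) * (1 + q * A k))) (A k) => s a s0 a0.
have : 0 <= q * a by rewrite mulr_ge0// ltW.
by move: q0; lra.
Qed.

Lemma Aseq_succ_gt0 k : 0 < A k.+1.
Proof.
have p0 : 0 < 1 - q by rewrite subr_gt0.
by rewrite -(pmulr_rgt0 _ p0) (lt_trans ltr01)// Aseq_succ_gt.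
Qed.

Lemma Aseq_den_gt0 k : 0 < 1 + q * A k.
Proof. by rewrite ltr_pwDl// mulr_ge0 ?Aseq_ge0// ltW. Qed.

Lemma item_delta_gt0 k : 0 < delta k.
Proof. by rewrite sqrtr_gt0 divr_gt0 ?Aseq_succ_gt0 ?Aseq_den_gt0. Qed.

Lemma item_delta_sqr k : delta k ^+ 2 * (1 + q * A k.+1) = A k.+1.
Proof.
rewrite sqr_sqrtr ?divfK ?gt_eqF ?Aseq_den_gt0//.
by rewrite divr_ge0 ?Aseq_ge0// ltW ?Aseq_den_gt0.
Qed.

(** Both sides are nonnegative and, by [Aseq_quadratic], have the same square. *)
Lemma item_delta_lin k :
  2 * delta k * (1 + q * A k.+1) = (1 + q) * A k.+1 - A k.
Proof.
have B0 := Aseq_den_gt0 k.+1; have d0 := item_delta_gt0 k.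
apply: (@pexpIrn _ 2) => //.
- by rewrite nnegrE !mulr_ge0 ?ltW.
- rewrite nnegrE; have := Aseq_le_succ k.
  have : 0 <= q * A k.+1 by rewrite mulr_ge0 ?Aseq_ge0// ltW.
  by move: (A k.+1) (A k) => b a; lra.
rewrite Aseq_quadratic -{2}(item_delta_sqr k); ring.
Qed.

Lemma item_delta_gt1 k : 1 < delta k.
Proof.
have := item_delta_sqr k; have := Aseq_succ_gt k; have := Aseq_den_gt0 k.+1.
have := item_delta_gt0 k; move: (delta k) (A k.+1) => d a d0 b0 a1 h.
rewrite ltNge; apply/negP => d1.
have : d ^+ 2 * (1 + q * a) <= 1 * (1 + q * a).
  by rewrite ler_pM2r// expr_le1// ltW.
by rewrite h; lra.
Qed.

Lemma item_delta_ltV k : q * delta k < 1.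
Proof.
have := item_delta_sqr k; have := Aseq_den_gt0 k.+1.
have := item_delta_gt0 k; have := Aseq_succ_gt0 k.
move: (delta k) (A k.+1) => d a a0 d0 b0 h; rewrite ltNge; apply/negP => qd.
have : 1 <= (q * d) ^+ 2 by rewrite expr_ge1// ltW// mulr_gt0.
move=> h2; have : (1 + q * a) * 1 <= (1 + q * a) * (q * d) ^+ 2.
  by rewrite ler_pM2l.
have -> : (1 + q * a) * (q * d) ^+ 2 = q * (q * a) by rewrite -{2}h; ring.
have : q * (q * a) <= 1 * (q * a) by rewrite ler_pM2r ?mulr_gt0// ltW.
by lra.
Qed.

(** The square is expanded with the two relations for [delta k]; this links the rates of consecutive
    iterations. *)
Lemma item_contraction k :
  (1 + q * A k.+1) * (1 - q * delta k) ^+ 2 = 1 + q * A k.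
Proof.
have -> : (1 + q * A k.+1) * (1 - q * delta k) ^+ 2 = (1 + q * A k.+1) -
  q * (2 * delta k * (1 + q * A k.+1)) +
  q ^+ 2 * (delta k ^+ 2 * (1 + q * A k.+1)) by ring.
by rewrite item_delta_lin item_delta_sqr; ring.
Qed.

End Scalars.

(** * The Lyapunov function and its decrease *)

Section Potential.
Variables (R : realType) (H : hilbertSpace R).
Local Notation "⟪ x , y ⟫" := (hinner x y).

(** Here [a] is [A_k], [U] the tilted value of [f] at the last gradient call, [z] the prox iterate
    minus the minimizer and [s] the tilted subgradient of [g] there. *)
Definition item_potential (q a U : R) (z s : H) : R :=
  a * U + (1 + q * a) * ⟪z, z⟫ + a / 2 * ⟪s, s⟫ + q * a * ⟪s, z⟫.

(** The decrease is a sum of nonnegative terms: convexity of [U] with weights [a] and [b - a], the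
    subgradient inequalities of [g] with weights [N] and [2 M - q b], multiples of [v] and [v'], and
    two squares. The weights make [v] and [v'] cancel. *)
Lemma item_potential_decrease (q a b d U U' v v' : R) (z s w r w' s' z' : H) :
  0 <= a -> a <= b -> 0 < d -> 0 < q -> q * d < 1 ->
  d ^+ 2 * (1 + q * b) = b -> 2 * d * (1 + q * b) = (1 + q) * b - a ->
  b *: (w' + r) = ((1 - q) * b - a) *: z + a *: (w - s) ->
  z' = (1 - q * d) *: z - d *: (r + s') ->
  0 <= a * (U - U' - ⟪r, w - w'⟫) -> U' <= ⟪r, w'⟫ ->
  0 <= a * (v' - v - ⟪s, z' - z⟫) -> 0 <= a * v -> 0 <= v' ->
  v' <= ⟪s', z'⟫ ->
  item_potential q b U' z' s' <= item_potential q a U z s.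
Proof.
move=> a0 ab d0 q0 qd hd2 hd hw hz hU hU' hv v0 v'0 hv'.
pose N := a / d; have Nd : N * d = a by rewrite divfK// gt_eqF.
(* [M] is [b / d], written without a division. *)
pose M := d * (1 + q * b); have Md : M * d = b by rewrite /M -[RHS]hd2; ring.
have hv2 : 0 <= N * (v' - v - ⟪s, z' - z⟫).
  by rewrite /N mulrAC divr_ge0// ltW.
have hv3 : 0 <= N * v by rewrite /N mulrAC divr_ge0// ltW.
have hU2 : 0 <= (b - a) * (⟪r, w'⟫ - U') by rewrite mulr_ge0// subr_ge0.
have b0 : 0 <= b by exact: le_trans ab.
have M0 : 0 <= M by rewrite /M !(mulr_ge0, addr_ge0)// ltW.
have Mq : q * b <= M by rewrite -Md mulrCA ler_piMr// ltW.
have NM : N <= M by rewrite -(ler_pM2r d0) Nd Md.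
have hv4 : 0 <= (2 * M - q * b) * (⟪s', z'⟫ - v').
  by rewrite mulr_ge0 ?subr_ge0//; lra.
have hv5 : 0 <= (2 * M - q * b - N) * v' by rewrite mulr_ge0//; lra.
have hs : 0 <= a / 2 * ⟪s - s', s - s'⟫ by rewrite mulr_ge0 ?inner_ge0//; lra.
have hs' : 0 <= (b - a) / 2 * ⟪s', s'⟫ by rewrite mulr_ge0 ?inner_ge0//; lra.
have Ew : b * (⟪r, w'⟫ + ⟪r, r⟫) =
    ((1 - q) * b - a) * ⟪r, z⟫ + a * (⟪r, w⟫ - ⟪r, s⟫).
  by have := congr1 (hinner r) hw; rewrite !innerE.
have E1 : (1 + q * b) * (1 - q * d) ^+ 2 = 1 + q * a.
  have -> : (1 + q * b) * (1 - q * d) ^+ 2 = (1 + q * b) -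
    q * (2 * d * (1 + q * b)) + q ^+ 2 * (d ^+ 2 * (1 + q * b)) by ring.
  by rewrite hd hd2; ring.
have E2 : 2 * ((1 + q * b) * (1 - q * d) * d) = (1 - q) * b - a.
  have -> : 2 * ((1 + q * b) * (1 - q * d) * d) = 2 * d * (1 + q * b) -
     2 * q * (d ^+ 2 * (1 + q * b)) by ring.
  by rewrite hd hd2; ring.
have Ez : (1 + q * b) * ⟪z', z'⟫ = (1 + q * a) * ⟪z, z⟫ -
    ((1 - q) * b - a) * ⟪r, z⟫ + b * ⟪r, r⟫ - 2 * M * ⟪s', z'⟫ - b * ⟪s', s'⟫.
  (* Isolates [s'] through [|z'|^2 = |z' + d s'|^2 - 2 d <s', z'> - d^2 |s'|^2]. *)
  transitivity (((1 + q * b) * (1 - q * d) ^+ 2) * ⟪z, z⟫ -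
    2 * ((1 + q * b) * (1 - q * d) * d) * ⟪r, z⟫ +
    d ^+ 2 * (1 + q * b) * ⟪r, r⟫ - 2 * M * ⟪s', z'⟫ -
    d ^+ 2 * (1 + q * b) * ⟪s', s'⟫); last by rewrite E1 E2 hd2.
  rewrite hz !innerE /M.
  by rewrite (hinner_sym z r) (hinner_sym z s') (hinner_sym r s'); ring.
have Es : N * ⟪s, z' - z⟫ = - a * (q * ⟪s, z⟫ + ⟪r, s⟫ + ⟪s, s'⟫).
  by rewrite -Nd hz !innerE (hinner_sym r s); ring.
rewrite /item_potential Ez.
move: hU hU2 hv2 hv3 hv4 hv5 hs hs' Es Ew; rewrite !innerE (hinner_sym s' s).
by clearbody N M; lra.
Qed.

End Potential.

(** * The convergence rate of Prox-ITEM *)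

Section UpperBound.
Variables (R : realType) (mu L : R) (H : hilbertSpace R) (f g : H -> \bar R).
Hypotheses (hmu : 0 < mu) (hmuL : mu < L).
Hypotheses (ff : Fclass mu L%:E f) (gg : Fclass 0 +oo%E g).
Variable xs : H.
Hypothesis hxs : is_argmin (fun x => f x + g x)%E xs.
Local Notation "⟪ x , y ⟫" := (hinner x y).
Local Notation q := (mu / L).
Local Notation A := (Aseq q).
Local Notation G := (grad f).

Let L0 : 0 < L. Proof. exact: lt_trans hmuL. Qed.
Let q0 : 0 < q. Proof. exact: divr_gt0. Qed.
Let q1 : q < 1. Proof. by rewrite ltr_pdivrMr ?mul1r. Qed.

(* In units of [L], and after tilting [f] by its gradient at [xs], a point [y]
   is sent to [w y]; interpolability of [f] in F_{mu,L} then says exactly that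
   [U] is a convex function of [w y] with subgradient [r y]. *)
Let h y : R := fine (f y) - mu / 2 * `|y| ^+ 2.
Let p y : H := G y - mu *: y.
Let r y : H := L^-1 *: (p y - p xs).
Let w y : H := (1 - q) *: (y - xs) - r y.
Let U y : R := (1 - q) * (L^-1 * (h y - h xs - ⟪p xs, y - xs⟫)) -
  2^-1 * ⟪r y, r y⟫.
(** [g] in units of [L], tilted by the gradient of [f] at [xs] so that its minimum is 0, attained at
    [xs]. *)
Let gt z : R := L^-1 * (fine (g z) - fine (g xs) + ⟪G xs, z - xs⟫).

(** The interpolation inequality multiplied by [(L - mu) / L ^+ 2] and expressed in [w] and [r]. *)
Let U_convex x y : U y + ⟪r y, w x - w y⟫ <= U x.
Proof.
have := Fclass_interpolation (ltW hmu) ff hmuL y x.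
rewrite -!/(h _) -!/(p _).
have pE z : p z = p xs + L *: r z.
  by rewrite /r scalerA mulfV ?gt_eqF// scale1r addrC subrK.
have -> : `|p y - p x| ^+ 2 = L ^+ 2 * ⟪r y - r x, r y - r x⟫.
  have -> : p y - p x = L *: (r y - r x).
    by rewrite (pE x) (pE y) scalerBr opprD addrACA subrr add0r.
  by rewrite hnorm_inner innerZl innerZr mulrA.
rewrite (pE y) /U /w.
move: (r x) (r y) (p xs) (h x) (h y) (h xs) => rx ry ps hx hy hs.
have c0 : 0 < (L - mu) / L ^+ 2.
  by rewrite divr_gt0 ?subr_gt0// exprn_gt0.
rewrite -(ler_pM2l c0) -subr_ge0 => hi; rewrite -subr_ge0; move: hi.
congr (0 <= _).
rewrite !innerE (hinner_sym ry rx); field.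
by rewrite !gt_eqF// subr_gt0.
Qed.

Let r_xs : r xs = 0. Proof. by rewrite /r subrr scaler0. Qed.
Let w_xs : w xs = 0. Proof. by rewrite /w r_xs !subrr scaler0 subr0. Qed.
Let U_xs : U xs = 0.
Proof. by rewrite /U r_xs !subrr !inner0r subrr !mulr0 subr0. Qed.

Let U_ge0 y : 0 <= U y.
Proof. by have := U_convex y xs; rewrite U_xs r_xs inner0l addr0. Qed.

Let U_le y : U y <= ⟪r y, w y⟫.
Proof.
by have := U_convex xs y; rewrite U_xs w_xs sub0r innerNr; lra.
Qed.

Let gt_ge0 z v : g z = v%:E -> 0 <= gt z.
Proof.
move=> gz; have [_ hs] := argmin_subgrad gg (ltW hmu) ff hxs.
have := hs z (fine (g z)); rewrite gz => /(_ (lexx _)).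
rewrite innerNl => hz; rewrite /gt gz mulr_ge0 ?invr_ge0 ?(ltW L0)//; lra.
Qed.

(** [Uk] and [wk] come from the last gradient call, [vk] and [s] from the last prox call; the factor
    [A k] makes the inequalities trivial at [k = 0], where no call has been made. *)
Definition item_invariant (c : R) (k : nat) (xz : H * H) : Prop :=
  exists (Uk vk : R) (wk s : H),
  [/\ xz.1 - xs = wk - s,
      forall y, 0 <= A k * (Uk - U y - ⟪r y, wk - w y⟫),
      forall z v, g z = v%:E -> 0 <= A k * (gt z - vk - ⟪s, z - xz.2⟫),
      [/\ 0 <= A k * vk, 0 <= A k * Uk & 0 <= A k * ⟪s, xz.2 - xs⟫] &
      item_potential q (A k) Uk (xz.2 - xs) s <= c].

Lemma item_invariant0 u0 : item_invariant (`|u0 - xs| ^+ 2) 0 (u0, u0).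
Proof.
(* With [s = 0] the first clause dictates [wk]. *)
exists 0, 0, (u0 - xs), 0; split => /= [|y|z v _||].
- by rewrite subr0.
- by rewrite mul0r.
- by rewrite mul0r.
- by rewrite !mul0r.
- by rewrite /item_potential !mul0r !mulr0 !mul0r !addr0 mul1r add0r hnorm_inner.
Qed.

Lemma item_invariantS c k xz : item_invariant c k xz ->
  item_invariant c k.+1 (item_step mu L f g k xz).
Proof.
case: xz => x z [Uk [vk [wk [s [xE hU hg [v0 Uk0 s0] hP]]]]].
rewrite /= in xE hg s0 hP.
pose b := A k / ((1 - q) * A k.+1); pose d := item_delta q k.
pose y := (1 - b) *: z + b *: x.
pose zb := (1 - q * d) *: z + (q * d) *: y - (d / L) *: G y.
pose z' := prox g (d / L) zb.
have -> : item_step mu L f g k (x, z) =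
  (y - L^-1 *: G y - d^-1 *: (zb - z'), z') by [].
have d0 : 0 < d := item_delta_gt0 q0 q1 k.
have A0 := Aseq_succ_gt0 q0 q1 k.
have dL0 : 0 < d / L by rewrite divr_gt0.
have := prox_subgrad gg zb dL0; rewrite -/z'.
set sg := _ *: (zb - z') => -[gz' hsg].
(* The subgradient of [gt] at [z']: the prox residual shifted by the tilt, in units of [L]. *)
pose s' := d^-1 *: (zb - z') + L^-1 *: G xs.
have sgE : sg = L *: s' - G xs.
  rewrite /s' scalerDr !scalerA mulfV ?gt_eqF// scale1r addrK.
  by rewrite /sg invf_div.
have gt_convex t v : g t = v%:E -> gt z' + ⟪s', t - z'⟫ <= gt t.
  move=> gtv; have := hsg t (fine (g t)); rewrite gtv => /(_ (lexx _)).
  rewrite sgE => ht; rewrite /gt gtv -subr_ge0.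
  rewrite -(pmulr_rge0 _ L0); move: ht; rewrite -subr_ge0; congr (0 <= _).
  by clearbody s'; rewrite !innerE; field; rewrite gt_eqF.
have gxs : g xs = (fine (g xs))%:E.
  by have [] := argmin_subgrad gg (ltW hmu) ff hxs.
have gtxs : gt xs = 0 by rewrite /gt !subrr inner0r addr0 mulr0.
have gt_le : gt z' <= ⟪s', z' - xs⟫.
  by have := gt_convex _ _ gxs; rewrite gtxs !innerE; lra.
have gt0 : 0 <= gt z' := gt_ge0 gz'.
have z'E : z' - xs = (1 - q * d) *: (z - xs) - d *: (r y + s').
  apply: inner_inj => t; rewrite /s' /r /p !innerE.
  by field; rewrite !gt_eqF.
(* The weight [beta_k] is the one that makes [A k.+1 *: (1 - q) *: (y - xs)] this combination of the
   previous iterates. *)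
have hw : A k.+1 *: (w y + r y) =
    ((1 - q) * A k.+1 - A k) *: (z - xs) + A k *: (wk - s).
  rewrite -xE /w subrK /y; apply: inner_inj => t; rewrite !innerE /b.
  have c0 : 1 - q != 0 by rewrite subr_eq0 gt_eqF.
  have A0' : A k.+1 != 0 by rewrite gt_eqF.
  by move: q (A k) (A k.+1) c0 A0' => q' a a' c0 A0'; field; rewrite A0' c0.
exists (U y), (gt z'), (w y), s'; split => /=.
- apply: inner_inj => t; rewrite /s' /w /r /p !innerE; field.
  by rewrite !gt_eqF.
- move=> y'; rewrite mulr_ge0 ?(ltW A0)//.
  by have := U_convex y y'; lra.
- move=> t v gtv; rewrite mulr_ge0 ?(ltW A0)//.
  by have := gt_convex _ _ gtv; lra.
- split; rewrite mulr_ge0 ?(ltW A0)//.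
  exact: le_trans gt_le.
apply: le_trans hP.
apply: (@item_potential_decrease _ _ _ _ _ d _ _ vk (gt z') _ _ wk (r y) (w y)).
- exact: Aseq_ge0.
- exact: Aseq_le_succ.
- exact: d0.
- exact: q0.
- exact: item_delta_ltV.
- exact: item_delta_sqr.
- exact: item_delta_lin.
- exact: hw.
- exact: z'E.
- exact: hU.
- exact: U_le.
- have -> : z' - xs - (z - xs) = z' - z by rewrite opprB addrA subrK.
  exact: hg gz'.
- exact: v0.
- exact: gt0.
- exact: gt_le.
Qed.

(** The initial potential is [|u0 - xs|^2] since [A 0 = 0]; in the final one all terms besides
    [(1 + q A_k) |z - xs|^2] are nonnegative. *)
Lemma prox_item_rate k u0 :
  (1 + q * A k) * `|prox_item mu L k f g u0 - xs| ^+ 2 <= `|u0 - xs| ^+ 2.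
Proof.
have : item_invariant (`|u0 - xs| ^+ 2) k (item_iter mu L f g k u0).
  by elim: k => [|k IH]; [exact: item_invariant0|exact: item_invariantS].
move=> [Uk [vk [wk [s [_ _ _ [_ Uk0 s0] hP]]]]].
apply: le_trans hP; rewrite /item_potential hnorm_inner /prox_item.
have : 0 <= A k / 2 * ⟪s, s⟫.
  by rewrite mulr_ge0 ?inner_ge0// divr_ge0 ?Aseq_ge0.
have := mulr_ge0 (ltW q0) s0; rewrite mulrA.
by move: Uk0; lra.
Qed.

End UpperBound.

(** * Spans of finite families *)

Section Span.
Variables (R : realType) (H : hilbertSpace R) (s : nat -> H).
Implicit Types (x y : H) (n : nat).

Lemma in_span0 n : in_span s n 0.
Proof. by exists (fun=> 0); rewrite big1// => i _; rewrite scale0r. Qed.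

Lemma in_spanD n x y : in_span s n x -> in_span s n y -> in_span s n (x + y).
Proof.
move=> [c ->] [d ->]; exists (fun i => c i + d i).
by rewrite -big_split; apply: eq_bigr => i _; rewrite scalerDl.
Qed.

Lemma in_spanZ n a x : in_span s n x -> in_span s n (a *: x).
Proof.
move=> [c ->]; exists (fun i => a * c i).
by rewrite scaler_sumr; apply: eq_bigr => i _; rewrite scalerA.
Qed.

Lemma in_span_gen n i : (i < n)%N -> in_span s n (s i).
Proof.
move=> ni; exists (fun j => (j == i)%:R).
rewrite (bigD1 (Ordinal ni))//= eqxx scale1r big1 ?addr0// => j ji.
by rewrite -[_ == _]/(_ == val (Ordinal ni)) (inj_eq val_inj) (negPf ji) scale0r.
Qed.

Lemma in_spanS n x : in_span s n x -> in_span s n.+1 x.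
Proof.
move=> [c ->]; exists (fun i => if (i < n)%N then c i else 0).
rewrite big_ord_recr/= ltnn scale0r addr0.
by apply: eq_bigr => i _; rewrite ltn_ord.
Qed.

End Span.

(** * Prox-ITEM belongs to the algorithm class *)

Section Membership.
Variables (R : realType) (mu L : R) (H : hilbertSpace R) (f g : H -> \bar R).
Hypotheses (hmu : 0 < mu) (hmuL : mu < L).
Variable u0 : H.
Local Notation q := (mu / L).
Local Notation A := (Aseq q).
Let xz j := item_iter mu L f g j u0.
Let b j := A j / ((1 - q) * A j.+1).
Let d := item_delta q.
Let y j := (1 - b j) *: (xz j).2 + b j *: (xz j).1.
Let zb j := (1 - q * d j) *: (xz j).2 + (q * d j) *: y j -
  (d j / L) *: grad f (y j).
Let z' j := prox g (d j / L) (zb j).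
(** The calls alternate: index [2 j] is the gradient at [y j], index [2 j + 1] the prox at
    [zb j]. *)
Let v l := if odd l then zb l./2 else y l./2.
Let s l := if odd l then (d l./2 / L)^-1 *: (zb l./2 - z' l./2)
           else grad f (y l./2).

Let L0 : 0 < L. Proof. exact: lt_trans hmuL. Qed.
Let q0 : 0 < q. Proof. exact: divr_gt0. Qed.
Let q1 : q < 1. Proof. by rewrite ltr_pdivrMr ?mul1r. Qed.
Let d0 j : 0 < d j. Proof. exact: item_delta_gt0. Qed.

Let xzS j : xz j.+1 =
  (y j - L^-1 *: grad f (y j) - (d j)^-1 *: (zb j - z' j), z' j).
Proof.
have -> : xz j.+1 = item_step mu L f g j (xz j) by [].
by rewrite /z' /zb /y; case: (xz j).
Qed.

Let s_even j : s j.*2 = grad f (y j).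
Proof. by rewrite /s odd_double doubleK. Qed.

Let s_odd j : s j.*2.+1 = (d j / L)^-1 *: (zb j - z' j).
Proof. by rewrite /s /= odd_double /= uphalf_double. Qed.

Let y_span j : in_span s j.*2 ((xz j).1 - u0) ->
  in_span s j.*2 ((xz j).2 - u0) -> in_span s j.*2 (y j - u0).
Proof.
move=> hx hz; have -> : y j - u0 =
    (1 - b j) *: ((xz j).2 - u0) + b j *: ((xz j).1 - u0).
  by apply: inner_inj => t; rewrite /y !innerE; ring.
by apply: in_spanD; apply: in_spanZ.
Qed.

Let zb_span j : in_span s j.*2 ((xz j).1 - u0) ->
  in_span s j.*2 ((xz j).2 - u0) -> in_span s j.*2.+1 (zb j - u0).
Proof.
move=> hx hz; have -> : zb j - u0 = (1 - q * d j) *: ((xz j).2 - u0) +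
    (q * d j) *: (y j - u0) + (- (d j / L)) *: s j.*2.
  by apply: inner_inj => t; rewrite s_even /zb !innerE; ring.
apply: in_spanD; last by apply: in_spanZ; apply: in_span_gen.
by apply: in_spanS; apply: in_spanD; apply: in_spanZ => //; exact: y_span.
Qed.

Let xz_span j : in_span s j.*2 ((xz j).1 - u0) /\
  in_span s j.*2 ((xz j).2 - u0).
Proof.
elim: j => [|j [hx hz]]; first by rewrite subrr; split; exact: in_span0.
have dL0 : 0 < d j / L by rewrite divr_gt0.
have sE : zb j - z' j = (d j / L) *: s j.*2.+1.
  by rewrite s_odd scalerA mulfV ?scale1r// gt_eqF.
rewrite xzS doubleS /=; split.
  (* The prox step [d j / L] cancels the factor [(d j)^-1] and leaves the coefficient [- L^-1]. *)
  have -> : y j - L^-1 *: grad f (y j) - (d j)^-1 *: (zb j - z' j) - u0 =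
      (y j - u0) + (- L^-1) *: s j.*2 + (- (L^-1)) *: s j.*2.+1.
    rewrite sE s_even; apply: inner_inj => t; rewrite !innerE; field.
    by rewrite !gt_eqF.
  apply: in_spanD; last by apply: in_spanZ; apply: in_span_gen.
  apply: in_spanS; apply: in_spanD; first exact/in_spanS/y_span.
  by apply: in_spanZ; apply: in_span_gen.
have -> : z' j - u0 = (zb j - u0) + (- (d j / L)) *: s j.*2.+1.
  by rewrite scaleNr -sE; apply: inner_inj => t; rewrite !innerE; ring.
apply: in_spanD; first exact/in_spanS/zb_span.
by apply: in_spanZ; apply: in_span_gen.
Qed.

Lemma prox_item_admissible k : exists (m : nat) (theta : nat -> bool)
    (gamma : nat -> R) (v s : nat -> H),
  [/\ (k <= m)%N /\ (\sum_(l < m) (theta l : nat))%N = k,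
      v 0%N = u0,
      (forall l, (l < m)%N ->
         if theta l then s l = grad f (v l)
         else 0 < gamma l /\
              s l = (gamma l)^-1 *: (v l - prox g (gamma l) (v l))),
      (forall l, (1 <= l < m)%N -> in_span s l (v l - u0)) &
      in_span s m (prox_item mu L k f g u0 - u0)].
Proof.
exists k.*2, (fun l => ~~ odd l), (fun l => d l./2 / L), v, s; split.
- split; first by rewrite -addnn leq_addr.
  elim: k => [|k IH]; first by rewrite big_ord0.
  by rewrite doubleS !big_ord_recr/= IH odd_double /= addn0 addn1.
(* [A 0 = 0] makes [b 0] vanish, so the first query point is [u0]. *)
- by rewrite /v /= /y /b /= !mul0r scale0r subr0 scale1r addr0.
- move=> l _; rewrite /s /v; case: (odd l) => //=.
  by split => //; rewrite divr_gt0.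
- move=> l _; rewrite -(odd_double_half l) /v.
  have [hx hz] := xz_span l./2.
  case: (odd l); last by rewrite add0n odd_double doubleK; exact: y_span.
  by rewrite add1n /= odd_double /= uphalf_double; exact: zb_span.
- by have [] := xz_span k.
Qed.

End Membership.

(** * The worst-case function *)

Section Moreau.
Variables (R : realType) (H : hilbertSpace R).
Implicit Types (x y z d : H).
Local Notation "⟪ x , y ⟫" := (hinner x y).

(** * From a cocoercivity inequality to smoothness and strong convexity *)

Section Cocoercive.
Variables (mu gamma : R) (h : H -> R) (S : H -> H).
Hypotheses (mu0 : 0 <= mu) (gamma0 : 0 < gamma).
Hypothesis hS : forall x y,
  h x + ⟪S x, y - x⟫ + gamma / 2 * ⟪S x - S y, S x - S y⟫ <= h y.

Let F x : R := mu / 2 * `|x| ^+ 2 + h x.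
Let f x : \bar R := (F x)%:E.
Let G x : H := mu *: x + S x.

Let F_lower x y : F x + ⟪G x, y - x⟫ + mu / 2 * ⟪y - x, y - x⟫ <= F y.
Proof.
have := hS x y; have : 0 <= gamma / 2 * ⟪S x - S y, S x - S y⟫.
  by rewrite mulr_ge0 ?inner_ge0// divr_ge0// ltW.
rewrite /F /G !hnorm_inner; move: (S x) (h x) (h y) (gamma / 2 * _) => s a b c.
by rewrite !innerE (hinner_sym y x); lra.
Qed.

(** Cocoercivity from [x + d] to [x], with Young's inequality for [<S (x + d) - S x, d>]. *)
Let F_upper x d :
  F (x + d) <= F x + ⟪G x, d⟫ + (mu + gamma^-1) / 2 * `|d| ^+ 2.
Proof.
have := hS (x + d) x; have -> : x - (x + d) = - d.
  by rewrite opprD addrA subrr add0r.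
have : 0 <= gamma^-1 / 2 * ⟪gamma *: (S (x + d) - S x) - d,
    gamma *: (S (x + d) - S x) - d⟫.
  by rewrite mulr_ge0 ?inner_ge0// divr_ge0// invr_ge0 ltW.
rewrite /F /G !hnorm_inner.
move: (S x) (S (x + d)) (h x) (h (x + d)) => s t a b h1 h2.
rewrite -subr_ge0; have := addr_ge0 h1 (_ : 0 <= _ - _).
move: h2; rewrite -subr_ge0 => h2 /(_ _ _ h2); congr (0 <= _).
rewrite !innerE (hinner_sym d x) (hinner_sym d s) (hinner_sym d t).
by rewrite (hinner_sym t s); field; rewrite gt_eqF.
Qed.

Lemma cocoercive_frechet_grad x : frechet_grad f x (G x).
Proof.
split=> // e e0; have c0 : 0 < mu + gamma^-1.
  by rewrite ltr_wpDl ?invr_gt0.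
(* The remainder lies between 0 and [(mu + 1/gamma)/2 |d|^2], which this radius makes at most
   [e |d|]. *)
exists (2 * e / (mu + gamma^-1)); first by rewrite divr_gt0 ?mulr_gt0.
move=> d; rewrite ltr_pdivlMr// => hd; split => //=.
have := F_lower x (x + d); have -> : x + d - x = d by rewrite addrAC subrr add0r.
have : 0 <= mu / 2 * ⟪d, d⟫ by rewrite mulr_ge0 ?inner_ge0// divr_ge0.
have : (mu + gamma^-1) / 2 * `|d| ^+ 2 <= e * `|d|.
  by rewrite expr2 mulrA; apply: ler_wpM2r => //; lra.
have e1 : 0 <= e * `|d| by rewrite mulr_ge0// ltW.
rewrite ler_norml => h1 h2 h3; have h4 := F_upper x d.
by apply/andP; split; lra.
Qed.

Lemma cocoercive_lipschitz x y : `|S x - S y| <= gamma^-1 * `|x - y|.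
Proof.
have h4 : gamma * `|S x - S y| ^+ 2 <= `|S x - S y| * `|x - y|.
  apply: le_trans (inner_le_norm _ _); have := lerD (hS x y) (hS y x).
  rewrite hnorm_inner; move: (S x) (S y) (h x) (h y) => u v a b.
  by rewrite !innerE (hinner_sym v u); lra.
have [->|] := eqVneq `|S x - S y| 0.
  by rewrite mulr_ge0// invr_ge0 ltW.
rewrite normr_eq0 -normr_gt0 => n0.
by rewrite ler_pdivlMl// -(ler_pM2l n0) mulrCA -expr2.
Qed.

Lemma cocoercive_Fclass : Fclass mu (mu + gamma^-1)%:E f.
Proof.
split.
- by split; [exists 0|].
- move=> x r; rewrite lte_fin => rx.
  have G1 : 0 < `|G x| + 1 by have := normr_ge0 (G x); lra.
  exists ((F x - r) / (`|G x| + 1)); first by rewrite divr_gt0// subr_gt0.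
  move=> y; rewrite ltr_pdivlMr// => hy; rewrite lte_fin.
  have := F_lower x y.
  have : 0 <= mu / 2 * ⟪y - x, y - x⟫ by rewrite mulr_ge0 ?inner_ge0// divr_ge0.
  have := inner_le_norm (- G x) (y - x); rewrite innerNl normrN.
  by have := normr_ge0 (y - x); lra.
- move=> x y t /andP[t0 t1].
  rewrite /f -!EFinM -!EFinD lee_fin.
  (* Averaging the lower bounds based at [m] with weights [t] and [1 - t] cancels the gradient
     terms. *)
  set m := t *: x + (1 - t) *: y.
  have := F_lower m x; have := F_lower m y.
  have -> : x - m = (1 - t) *: (x - y).
    by apply: inner_inj => s; rewrite /m !innerE; ring.
  have -> : y - m = (- t) *: (x - y).
    by apply: inner_inj => s; rewrite /m !innerE; ring.
  rewrite hnorm_inner; move: (F m) (G m) (F x) (F y) (x - y) => a s b c d.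
  have s0 : 0 < 1 - t by rewrite subr_gt0.
  move=> /(ler_wpM2l (ltW s0)) h1 /(ler_wpM2l (ltW t0)) h2.
  by have := lerD h1 h2; rewrite !innerE; lra.
- move=> l [<-]; exists G; split; first exact: cocoercive_frechet_grad.
  move=> x y; rewrite /G opprD addrACA -scalerBr mulrDl.
  apply: (le_trans (ler_normD _ _)); rewrite normrZ ger0_norm// lerD2l.
  exact: cocoercive_lipschitz.
Qed.

End Cocoercive.

(** * Maxima of affine functions and their Moreau envelopes *)

Section MaxAffine.
Variables (s : nat -> H) (c : H).
Let l j x : R := ⟪s j, x - c⟫.

Fixpoint max_affine n x : R :=
  if n is n'.+1 then Num.max (max_affine n' x) (l n x) else l 0 x.

Lemma max_affine_ge n j x : (j <= n)%N -> l j x <= max_affine n x.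
Proof.
elim: n => [|n IH]; first by rewrite leqn0 => /eqP ->.
by rewrite leq_eqVlt ltnS le_max => /predU1P[->|/IH ->//]; rewrite lexx orbT.
Qed.

Lemma max_affine_le n x a : (forall j, (j <= n)%N -> l j x <= a) ->
  max_affine n x <= a.
Proof.
elim: n => [|n IH] h /=; first exact: h.
by rewrite ge_max h// IH// => j jn; rewrite h// ltnW.
Qed.

Lemma max_affine_Fclass n : Fclass 0 +oo%E (fun x => (max_affine n x)%:E).
Proof.
split.
- by split; [exists 0|].
- move=> x r; rewrite lte_fin => rx.
  have [j jn rj] : exists2 j, (j <= n)%N & r < l j x.
    apply: contrapT => h; move: rx; rewrite ltNge => /negP; apply.
    apply: max_affine_le => j jn; rewrite leNgt; apply/negP => rj.
    by apply: h; exists j.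
  have s1 : 0 < `|s j| + 1 by have := normr_ge0 (s j); lra.
  exists ((l j x - r) / (`|s j| + 1)); first by rewrite divr_gt0// subr_gt0.
  move=> y; rewrite ltr_pdivlMr// => hy; rewrite lte_fin.
  apply: (lt_le_trans _ (max_affine_ge y jn)).
  have := inner_le_norm (- s j) (y - x); have := normr_ge0 (y - x).
  by move: hy; rewrite normrN /l !innerE; lra.
- move=> x y t /andP[t0 t1].
  rewrite !mul0r sube0 -!EFinM -!EFinD lee_fin.
  apply: max_affine_le => j jn.
  have s0 : 0 < 1 - t by rewrite subr_gt0.
  have := max_affine_ge x jn; have := max_affine_ge y jn.
  move=> /(ler_wpM2l (ltW s0)) h1 /(ler_wpM2l (ltW t0)) h2.
  by have := lerD h1 h2; rewrite /l !innerE; lra.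
- by [].
Qed.

Variable gamma : R.
Hypothesis gamma0 : 0 < gamma.

Definition max_affine_prox n x : H :=
  prox (fun x => (max_affine n x)%:E) gamma x.
Local Notation P := max_affine_prox.

Lemma max_affine_proxP n x y :
  max_affine n (P n x) + ⟪gamma^-1 *: (x - P n x), y - P n x⟫ <=
    max_affine n y.
Proof.
have [_] := prox_subgrad (max_affine_Fclass n) x gamma0.
by move=> /(_ y (max_affine n y) (lexx _)).
Qed.

(** Adding the subgradient inequalities at [z] and at [P n x] gives
    [gamma^-1 |P n x - z|^2 <= 0]. *)
Lemma max_affine_prox_unique n x z :
  (forall y, max_affine n z + ⟪gamma^-1 *: (x - z), y - z⟫ <= max_affine n y) ->
  P n x = z.
Proof.
move=> hz; apply/eqP; rewrite -subr_eq0; apply/eqP/inner_eq0.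
rewrite -(ler_pM2l (_ : 0 < gamma^-1)) ?invr_gt0// mulr0.
have := lerD (hz (P n x)) (max_affine_proxP n x z).
move: (max_affine n z) (max_affine n (P n x)) (P n x) => a b p.
by rewrite !innerE (hinner_sym z p) (hinner_sym x z) (hinner_sym x p); lra.
Qed.

Definition envelope_grad n x : H := gamma^-1 *: (x - P n x).
(** The Moreau envelope: the second term is the usual penalty [|x - P x|^2 / (2 gamma)]. *)
Definition envelope n x : R := max_affine n (P n x) +
  gamma / 2 * ⟪envelope_grad n x, envelope_grad n x⟫.

(** The subgradient inequality at [P x] tested at [P y], after substituting
    [z = P z + gamma S z]. *)
Lemma envelope_cocoercive n x y (S := envelope_grad n) :
  envelope n x + ⟪S x, y - x⟫ + gamma / 2 * ⟪S x - S y, S x - S y⟫ <=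
    envelope n y.
Proof.
have := max_affine_proxP n x (P n y); rewrite /envelope -/(envelope_grad n x).
have E z : z = P n z + gamma *: S z.
  by rewrite /S /envelope_grad scalerA mulfV ?gt_eqF// scale1r addrC subrK.
have -> : y - x = P n y - P n x + gamma *: (S y - S x).
  by rewrite {1}(E y) {1}(E x) opprD addrACA scalerBr.
rewrite -/S; move: (S x) (S y) (P n y - P n x) => u v d.
by rewrite !innerE (hinner_sym v u); lra.
Qed.

End MaxAffine.
End Moreau.

(** * The zero function as nonsmooth term *)

Section ZeroFunction.
Variables (R : realType) (H : hilbertSpace R).

Lemma Fclass_cst0 : @Fclass R H 0 +oo%E (fun=> 0%E).
Proof.
split=> [|x r|x y t _|//]; first by split; [exists 0|].
  by move=> r0; exists 1.
by rewrite !mule0 adde0 !mul0r sube0.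
Qed.

Lemma prox0 (gamma : R) (x : H) : 0 < gamma -> prox (fun=> 0%E) gamma x = x.
Proof.
move=> gamma0; have [_] := prox_subgrad Fclass_cst0 x gamma0.
move=> /(_ x 0 (lexx _)); rewrite add0r innerZl pmulr_rle0 ?invr_gt0//.
by move=> /inner_eq0 /eqP; rewrite subr_eq0 => /eqP.
Qed.

End ZeroFunction.

(** * Weights of the worst-case function *)

Section HardScalars.
Variables (R : realType) (q : R).
Hypotheses (q0 : 0 < q) (q1 : q < 1).
Local Notation A := (Aseq q).
Local Notation delta := (item_delta q).

(** In the hard instance [X j] is [nu j * kap j]; the recursion is the one for which
    [<sl j, sl k> = (1 + q A_j) X_j]. *)
Fixpoint hard_weight j : R := if j is i.+1 then
  hard_weight i * ((1 - q * delta i) * (1 - (delta i)^-1)) else 1.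
Local Notation X := hard_weight.

Lemma hard_weight_gt0 j : 0 < X j.
Proof.
elim: j => [//|j IH] /=; rewrite !mulr_gt0 ?subr_gt0 ?item_delta_ltV//.
by rewrite invf_lt1 ?item_delta_gt0 ?item_delta_gt1.
Qed.

Let den_sqr j : (1 + q * A j.+1) * (1 - q * delta j ^+ 2) = 1.
Proof.
transitivity (1 + q * A j.+1 - q * (delta j ^+ 2 * (1 + q * A j.+1))).
  by move: (A j.+1) => a; ring.
by rewrite item_delta_sqr// addrK.
Qed.

(** By [item_contraction] the difference contains the factor [(1 + q * A j.+1) * (1 - q * delta j ^+
    2)], which is 1. *)
Lemma hard_weight_gap j : (1 + q * A j) * X j - (1 + q * A j.+1) * X j.+1 =
  X j * ((1 - q * delta j) / delta j).
Proof.
rewrite [X j.+1]/= -item_contraction//.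
have d0 : delta j != 0 by rewrite gt_eqF ?item_delta_gt0.
have := den_sqr j; move: (1 + q * A j.+1) (X j) (delta j) d0 => B x d d0 hB.
have -> : x * ((1 - q * d) / d) = x * ((1 - q * d) / d) * (B * (1 - q * d ^+ 2)).
  by rewrite hB mulr1.
by field.
Qed.

(** Telescoping: from [j] to [j + 1] both sides change by
    [- X j * ((1 - q * delta j) / delta j)]. *)
Lemma hard_weight_sum j : (1 + q * A j) * X j =
  \sum_(i < j) X i * (q * delta i) + X j.
Proof.
elim: j => [|j IH]; first by rewrite big_ord0 /= mulr0 addr0 mul1r add0r.
rewrite big_ord_recr /= -/(X j.+1).
have := hard_weight_gap j; rewrite IH => h.
have -> : (1 + q * A j.+1) * X j.+1 =
  \sum_(i < j) X i * (q * delta i) + X j - X j * ((1 - q * delta j) / delta j).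
  by rewrite -h subKr.
have d0 : delta j != 0 by rewrite gt_eqF ?item_delta_gt0.
rewrite [X j.+1]/=; move: (\sum_(i < j) _) (X j) (delta j) d0 => t x d d0.
by field.
Qed.

End HardScalars.

(** * The hard instance and its zero-chain property *)

Section HardInstance.
Variables (R : realType) (mu L : R) (k : nat) (H : hilbertSpace R).
Variable e : nat -> H.
Hypotheses (hmu : 0 < mu) (hmuL : mu < L).
Local Notation "⟪ x , y ⟫" := (hinner x y).
Hypothesis he : forall i j, (i <= k)%N -> (j <= k)%N -> ⟪e i, e j⟫ = (i == j)%:R.
Local Notation q := (mu / L).
Local Notation A := (Aseq q).
Local Notation delta := (item_delta q).
Local Notation X := (hard_weight q).

Let L0 : 0 < L. Proof. exact: lt_trans hmuL. Qed.
Let q0 : 0 < q. Proof. exact: divr_gt0. Qed.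
Let q1 : q < 1. Proof. by rewrite ltr_pdivrMr ?mul1r. Qed.

(* [eta k = 1] gives [nu k = kap k], so that [kap] lists the coordinates of
   [sl k]. The pieces all vanish at [cen], which is the prox of the minimizer,
   and the optimality condition is [mu *: hard_min + sl k = 0]. *)
Let eta j : R := if (j < k)%N then q * delta j else 1.
Let kap j : R := Num.sqrt (X j * eta j).
Let nu j : R := kap j / eta j.
Let part j : H := \sum_(i < j) kap i *: e i.
Let sl j : H := part j + nu j *: e j.
Let gamma : R := (L - mu)^-1.
Let theta : R := mu^-1 + gamma.
Let cen : H := - theta *: sl k.
Local Notation P := (max_affine_prox sl cen gamma).

Let gamma0 : 0 < gamma. Proof. by rewrite invr_gt0 subr_gt0. Qed.
Let theta0 : 0 < theta. Proof. by apply: addr_gt0 gamma0; rewrite invr_gt0. Qed.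
Let thetaE : theta = gamma / q.
Proof.
have c0 : 0 < L - mu by rewrite subr_gt0.
by rewrite /theta /gamma; field; rewrite !gt_eqF.
Qed.

Let eta0 j : 0 < eta j.
Proof. by rewrite /eta; case: ifP => // _; rewrite mulr_gt0 ?item_delta_gt0. Qed.
Let eta1 j : eta j <= 1.
Proof. by rewrite /eta; case: ifP => // _; rewrite ltW ?item_delta_ltV. Qed.
Let kap_sqr j : kap j ^+ 2 = X j * eta j.
Proof. by rewrite sqr_sqrtr// mulr_ge0 ?(ltW (eta0 j)) ?ltW ?hard_weight_gt0. Qed.
Let nuE j : kap j = nu j * eta j.
Proof. by rewrite /nu divfK// gt_eqF. Qed.
Let nu0 j : 0 <= nu j.
Proof. by rewrite divr_ge0 ?sqrtr_ge0// ltW. Qed.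
Let nu_kap j : nu j * kap j = X j.
Proof.
by rewrite /nu mulrAC -expr2 kap_sqr mulfK// gt_eqF.
Qed.

Let inner_part j x : ⟪part j, x⟫ = \sum_(i < j) kap i * ⟪e i, x⟫.
Proof.
rewrite hinner_sym inner_sumr; apply: eq_bigr => i _.
by rewrite innerZr hinner_sym.
Qed.

Let inner_part_gt j i : (j <= i)%N -> (i <= k)%N -> ⟪part j, e i⟫ = 0.
Proof.
move=> ji ik; rewrite inner_part big1// => m _.
have mi : (m < i)%N by exact: leq_trans ji.
by rewrite he// ?(ltnW (leq_trans mi _))// ltn_eqF// mulr0.
Qed.

Let inner_sl_gt j i : (j < i)%N -> (i <= k)%N -> ⟪sl j, e i⟫ = 0.
Proof.
move=> ji ik; rewrite innerDl innerZl inner_part_gt ?(ltnW ji)//.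
by rewrite he ?ltn_eqF ?mulr0 ?addr0// ltnW// (leq_trans ji).
Qed.

Let inner_sl_diag i : (i <= k)%N -> ⟪sl i, e i⟫ = nu i.
Proof.
by move=> ik; rewrite innerDl innerZl inner_part_gt// he// eqxx add0r mulr1.
Qed.

Let inner_sl_lt i : (i <= k)%N -> ⟪e i, sl k⟫ = kap i.
Proof.
rewrite leq_eqVlt => /predU1P[->|ik].
  by rewrite hinner_sym inner_sl_diag// /nu /eta ltnn divr1.
rewrite hinner_sym innerDl innerZl inner_part (bigD1 (Ordinal ik))//=.
rewrite he ?eqxx ?(ltnW ik)// mulr1 big1 ?addr0.
  by rewrite he ?gtn_eqF ?mulr0 ?addr0// ltnW.
move=> m mi; rewrite he ?(ltnW ik)//; last exact: ltnW.
by rewrite -[_ == i]/(_ == val (Ordinal ik)) (inj_eq val_inj) (negPf mi) mulr0.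
Qed.

Let inner_sl_last j : (j <= k)%N -> ⟪sl j, sl k⟫ = (1 + q * A j) * X j.
Proof.
move=> jk; rewrite innerDl innerZl inner_part inner_sl_lt// nu_kap.
rewrite hard_weight_sum//; congr (_ + _); apply: eq_bigr => i _.
have ik : (i < k)%N by exact: leq_trans jk.
by rewrite inner_sl_lt ?(ltnW ik)// -expr2 kap_sqr /eta ik.
Qed.

Let inner_sl_anti i j : (i < j)%N -> (j <= k)%N ->
  ⟪sl j, sl k⟫ <= ⟪sl i.+1, sl k⟫.
Proof.
elim: j => [//|j IH]; rewrite ltnS leq_eqVlt => /predU1P[->//|ij] jk.
apply: le_trans (IH ij (ltnW jk)); rewrite !inner_sl_last// 1?ltnW//.
rewrite -subr_ge0 hard_weight_gap// mulr_ge0 ?(ltW (hard_weight_gt0 _ _ _))//.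
by apply: divr_ge0; rewrite ?subr_ge0 ltW ?item_delta_ltV ?item_delta_gt0.
Qed.

(** The coordinates of index [i] to [k] vanish; for [i > k] this holds of every vector. *)
Let supp (i : nat) x := forall m, (i <= m <= k)%N -> ⟪e m, x⟫ = 0.

Let part_supp i j w : (i < j)%N -> (j <= k.+1)%N -> supp i.+1 w ->
  ⟪part j, w⟫ = ⟪part i.+1, w⟫.
Proof.
elim: j => [//|j IH]; rewrite ltnS leq_eqVlt => /predU1P[->//|ij] jk ws.
rewrite -(IH ij (ltnW jk) ws) !inner_part big_ord_recr /= ws ?mulr0 ?addr0//.
by rewrite ij.
Qed.

(* The choice of the weights makes the gap [theta * <sl i - sl i.+1, sl k>]
   exactly the loss [gamma * nu i * (nu i - kap i)] that the prox can cause. *)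
Let l_le i j w : (i < j)%N -> (j <= k)%N -> supp i.+1 w ->
  - gamma * nu i <= ⟪e i, w⟫ <= 0 -> ⟪sl j, w - cen⟫ <= ⟪sl i, w - cen⟫.
Proof.
move=> ij jk ws /andP[w1 w2].
have ik : (i < k)%N by exact: leq_trans jk.
have h1 := inner_sl_anti ij jk.
have h2 : ⟪sl i, sl k⟫ - ⟪sl i.+1, sl k⟫ = q * (nu i * (nu i - kap i)).
  rewrite !inner_sl_last// 1?ltnW// hard_weight_gap// -nu_kap (nuE i).
  have dn0 : delta i != 0 by rewrite gt_eqF ?item_delta_gt0.
  by rewrite /eta ik; move: (nu i) (delta i) q dn0 => n d t dn0; field.
have h3 : 0 <= nu i - kap i.
  by rewrite (nuE i) subr_ge0 ler_piMr.
have h4 : - gamma * nu i * (nu i - kap i) <= ⟪e i, w⟫ * (nu i - kap i).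
  by rewrite ler_wpM2r.
have h5 := ler_wpM2l (ltW theta0) h1.
have h6 : theta * (⟪sl i, sl k⟫ - ⟪sl i.+1, sl k⟫) =
    gamma * (nu i * (nu i - kap i)).
  by rewrite h2 thetaE mulrA divfK// gt_eqF.
have E1 : ⟪sl j, w⟫ = ⟪part i, w⟫ + kap i * ⟪e i, w⟫.
  rewrite innerDl innerZl ws ?jk ?andbT// mulr0 addr0
    (part_supp ij)//; last exact: leqW.
  by rewrite !inner_part big_ord_recr.
have E2 : ⟪sl i, w⟫ = ⟪part i, w⟫ + nu i * ⟪e i, w⟫ by rewrite innerDl innerZl.
rewrite !(innerDr w) !innerNr E1 E2 /cen !innerZr.
by move: h4 h5 h6; lra.
Qed.

(** Let [w] be the prox of the first [i + 1] pieces alone. It is orthogonal to the later directions,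
    and by [l_le] no later piece exceeds piece [i] at [w], so [w] satisfies the prox condition for
    all pieces. *)
Let prox_chain i x : supp i x -> supp i.+1 (P k x).
Proof.
move=> xs; have [ik|ki] := ltnP i k; last first.
  by move=> m /andP[im mk]; have := leq_trans im mk; rewrite ltnNge ki.
pose w := P i x.
have hw y : max_affine sl cen i w + ⟪gamma^-1 *: (x - w), y - w⟫ <=
  max_affine sl cen i y by exact: max_affine_proxP.
have shift t m j : ⟪sl j, w + t *: e m - cen⟫ = ⟪sl j, w - cen⟫ + t * ⟪sl j, e m⟫.
  by rewrite !innerE; ring.
have grad_shift t m : (i <= m <= k)%N ->
    ⟪gamma^-1 *: (x - w), w + t *: e m - w⟫ = - (gamma^-1 * (t * ⟪e m, w⟫)).
  move=> /xs xm; rewrite addrAC subrr add0r !innerE (hinner_sym x) xm.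
  by rewrite (hinner_sym w); ring.
(* Moving along [e m] with [m > i] leaves the first [i + 1] pieces unchanged; unit moves both ways
   force the coordinate to vanish. *)
have ws : supp i.+1 w.
  move=> m /andP[im mk].
  have h t : 0 <= gamma^-1 * (t * ⟪e m, w⟫).
    have := hw (w + t *: e m); rewrite grad_shift ?(ltnW im)// => h1.
    have : max_affine sl cen i (w + t *: e m) <= max_affine sl cen i w.
      apply: max_affine_le => j ji; rewrite shift inner_sl_gt ?mulr0 ?addr0//.
        exact: max_affine_ge.
      exact: leq_ltn_trans im.
    by lra.
  have gV : 0 < gamma^-1 by rewrite invr_gt0.
  have := h 1; have := h (-1); rewrite !(pmulr_rge0 _ gV) mul1r mulN1r oppr_ge0.
  by move=> h1 h2; apply/eqP; rewrite eq_le h1 h2.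
(* Along [e i] only piece [i] changes, at rate [nu i]; unit moves both ways give the two bounds. *)
have wi : - gamma * nu i <= ⟪e i, w⟫ <= 0.
  have ii : (i <= i <= k)%N by rewrite leqnn ltnW.
  have h t : max_affine sl cen i (w + t *: e i) <=
      max_affine sl cen i w + Num.max 0 (t * nu i).
    apply: max_affine_le => j ji; rewrite shift.
    apply: lerD; first exact: max_affine_ge.
    move: ji; rewrite leq_eqVlt => /predU1P[->|ji].
      by rewrite inner_sl_diag ?(ltnW ik)// le_max lexx orbT.
    by rewrite inner_sl_gt ?(ltnW ik)// mulr0 le_max lexx.
  have gV : 0 < gamma^-1 by rewrite invr_gt0.
  have := le_trans (hw _) (h 1); have := le_trans (hw _) (h (-1)).
  rewrite !grad_shift// !mul1r !mulN1r (max_idPr (nu0 i)).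
  rewrite (max_idPl (_ : - nu i <= 0)) ?oppr_le0// addr0 => h1 h2.
  apply/andP; split.
    by rewrite mulNr lerNl -ler_pdivrMl//; move: h2; lra.
  by rewrite -(pmulr_rle0 _ gV); move: h1; lra.
have mE : max_affine sl cen k w = max_affine sl cen i w.
  apply/eqP; rewrite eq_le; apply/andP; split; apply: max_affine_le => j jk.
    have [ji|ij] := leqP j i; first exact: max_affine_ge.
    exact: le_trans (l_le ij jk ws wi) (max_affine_ge _ _ _ (leqnn i)).
  by apply: max_affine_ge; exact: leq_trans jk (ltnW ik).
suff -> : P k x = w by [].
apply: max_affine_prox_unique => // y; rewrite mE; apply: (le_trans (hw y)).
apply: max_affine_le => j ji; apply: max_affine_ge.
exact: leq_trans ji (ltnW ik).
Qed.

Definition hard_fun x : \bar R :=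
  (mu / 2 * `|x| ^+ 2 + envelope sl cen gamma k x)%:E.

Lemma hard_fun_Fclass : Fclass mu L%:E hard_fun.
Proof.
have -> : L = mu + gamma^-1 by rewrite /gamma invrK; lra.
apply: cocoercive_Fclass (ltW hmu) gamma0 _ => x y.
exact: envelope_cocoercive.
Qed.

Lemma hard_fun_grad x :
  grad hard_fun x = mu *: x + gamma^-1 *: (x - P k x).
Proof.
apply: grad_eq; have hS := envelope_cocoercive sl cen gamma0 k.
exact: cocoercive_frechet_grad (ltW hmu) gamma0 hS x.
Qed.

Lemma hard_fun_zero_chain i x : supp i x -> supp i.+1 (grad hard_fun x).
Proof.
move=> xs m /andP[im mk]; rewrite hard_fun_grad !innerE.
by rewrite xs ?(ltnW im)// (prox_chain xs) ?im// subrr !mulr0 addr0.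
Qed.

Definition hard_min : H := - mu^-1 *: sl k.

(** All pieces vanish at [cen], so [sl k] is a subgradient there, and it is the one that the prox
    equation requires. *)
Let P_min : P k hard_min = cen.
Proof.
apply: max_affine_prox_unique => // y.
have -> : gamma^-1 *: (hard_min - cen) = sl k.
  apply: inner_inj => t; rewrite /hard_min /cen !innerE /theta; field.
  by rewrite !gt_eqF.
have -> : max_affine sl cen k cen = 0.
  apply/eqP; rewrite eq_le; apply/andP; split.
    by apply: max_affine_le => j _; rewrite subrr inner0r.
  by have := max_affine_ge sl cen cen (leqnn k); rewrite subrr inner0r.
by rewrite add0r; exact: max_affine_ge.
Qed.

Lemma hard_fun_argmin x : fine (hard_fun hard_min) <= fine (hard_fun x).
Proof.
have := Fclass_lower (ltW hmu) hard_fun_Fclass hard_min x.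
have -> : grad hard_fun hard_min = 0.
  rewrite hard_fun_grad P_min; apply: inner_inj => t.
  rewrite /hard_min /cen !innerE /theta; field.
  by rewrite !gt_eqF.
rewrite inner0l addr0; apply: le_trans; rewrite lerDl.
by rewrite mulr_ge0 ?sqr_ge0// divr_ge0// ltW.
Qed.

Lemma hard_min_norm : `|hard_min| ^+ 2 = (1 + q * A k) * X k / mu ^+ 2.
Proof.
rewrite hnorm_inner /hard_min innerZl innerZr inner_sl_last//; field.
by rewrite !gt_eqF.
Qed.

(** Projection onto [e k]: the minimizer has coordinate [- kap k / mu] there, and [kap k ^+ 2 = X k]
    because [eta k = 1]. *)
Lemma hard_min_dist x : ⟪e k, x⟫ = 0 -> X k / mu ^+ 2 <= `|x - hard_min| ^+ 2.
Proof.
move=> xk; have ek : ⟪e k, x - hard_min⟫ = kap k / mu.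
  rewrite innerDr innerNr /hard_min innerZr xk inner_sl_lt//.
  by rewrite mulNr opprK add0r mulrC.
have ek1 : `|e k| = 1.
  by apply/eqP; rewrite -sqrp_eq1// hnorm_inner he// eqxx.
have := inner_le_norm (e k) (x - hard_min); rewrite ek ek1 mul1r => h.
have -> : X k / mu ^+ 2 = (kap k / mu) ^+ 2.
  by rewrite expr_div_n kap_sqr /eta ltnn mulr1.
have k0 : 0 <= kap k / mu by rewrite divr_ge0 ?sqrtr_ge0// ltW.
by rewrite ler_sqr ?nnegrE //; exact: le_trans h.
Qed.

Let supp_span n (s : nat -> H) i x :
  (forall j, (j < n)%N -> supp i (s j)) -> in_span s n x -> supp i x.
Proof.
move=> hs [c ->] m mk; rewrite inner_sumr big1// => j _.
by rewrite innerZr hs ?mulr0.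
Qed.

(** By induction, all that is known after [l] calls vanishes from coordinate [cnt l] on, since only
    gradient calls enlarge the support. After [k] gradient calls the output is still orthogonal to
    [e k]. *)
Lemma hard_fun_lower_bound (n : nat) (call : nat -> bool) (step : nat -> R)
    (v s : nat -> H) (u : H) :
  (\sum_(l < n) (call l : nat))%N = k -> v 0%N = 0 ->
  (forall l, (l < n)%N ->
     if call l then s l = grad hard_fun (v l)
     else 0 < step l /\
          s l = (step l)^-1 *: (v l - prox (fun=> 0%E) (step l) (v l))) ->
  (forall l, (1 <= l < n)%N -> in_span s l (v l)) -> in_span s n u ->
  1 / (1 + q * A k) <= `|u - hard_min| ^+ 2 / `|hard_min| ^+ 2.
Proof.
move=> hk v0 hs hv hu.
pose cnt l := (\sum_(i < l) (call i : nat))%N.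
have cntS l : cnt l.+1 = (cnt l + call l)%N by rewrite /cnt big_ord_recr.
have cnt_mono i j : (i <= j)%N -> (cnt i <= cnt j)%N.
  elim: j => [|j IH]; first by rewrite leqn0 => /eqP ->.
  rewrite leq_eqVlt => /predU1P[->//|ij].
  by rewrite cntS (leq_trans (IH ij))// leq_addr.
have supp_mono i j x : (i <= j)%N -> supp i x -> supp j x.
  by move=> ij xs m /andP[jm mk]; apply: xs; rewrite mk (leq_trans ij).
have hsupp l : (l < n)%N -> supp (cnt l.+1) (s l).
  elim/ltn_ind: l => l IH ln.
  have hvl : supp (cnt l) (v l).
    case: l IH ln => [|l] IH ln; first by move=> m _; rewrite v0 inner0r.
    apply: (@supp_span l.+1 s (cnt l.+1) (v l.+1) _ (hv l.+1 ln)) => j jl.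
    apply: (supp_mono _ _ _ (cnt_mono _ _ jl)).
    by apply: IH => //; exact: ltn_trans ln.
  rewrite cntS; have := hs l ln; case: (call l) => [->|[st0 ->]].
    by rewrite addn1; exact: hard_fun_zero_chain.
  (* The prox of the zero function returns its argument, so the call contributes the zero vector. *)
  by rewrite prox0// subrr scaler0 => m _; rewrite inner0r.
have uk : ⟪e k, u⟫ = 0.
  apply: (@supp_span n s k u _ hu); last by rewrite leqnn.
  move=> j jn; rewrite -hk; apply: (supp_mono _ _ _ (cnt_mono _ _ jn)).
  exact: hsupp.
have X0 := hard_weight_gt0 q0 q1 k; have B0 := Aseq_den_gt0 q0 q1 k.
rewrite hard_min_norm ler_pdivlMr ?divr_gt0 ?mulr_gt0 ?exprn_gt0//.
apply: le_trans (hard_min_dist uk); rewrite le_eqVlt; apply/orP; left.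
by apply/eqP; move: (1 + q * A k) B0 => B B0; field; rewrite !gt_eqF.
Qed.

End HardInstance.

(** * Matching bounds on the worst-case risk *)

Section RiskBounds.
Variables (R : realType) (mu L : R).
Hypotheses (hmu : 0 < mu) (hmuL : mu < L).
Local Notation q := (mu / L).

Let L0 : 0 < L. Proof. exact: lt_trans hmuL. Qed.
Let q0 : 0 < q. Proof. exact: divr_gt0. Qed.
Let q1 : q < 1. Proof. by rewrite ltr_pdivrMr ?mul1r. Qed.

Lemma risk_ge k (A : method R) : in_alg_class k mu L A ->
  ((1 / (1 + q * Aseq q k))%:E <= risk mu L A)%E.
Proof.
move=> hA; pose H := euclid_space R k.+1.
(* The standard basis; [inord] sends indices beyond [k] to 0, and only those up to [k] enter the
   instance. *)
pose e (j : nat) : H := delta_mx 0 (inord j : 'I_k.+1) : 'rV[R]_k.+1.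
have he i j : (i <= k)%N -> (j <= k)%N -> hinner (e i) (e j) = (i == j)%:R.
  move=> ik jk; rewrite [LHS]/(dot _ _) /dot (bigD1 (inord i))//= big1 ?addr0.
    rewrite !mxE !eqxx mul1r; congr (_%:R); congr nat_of_bool.
    by rewrite -val_eqE /= !inordK.
  by move=> m mi; rewrite !mxE (negPf mi) mul0r.
pose f := hard_fun mu L k e; pose xs := hard_min mu L k e.
have ff : Fclass mu L%:E f by exact: hard_fun_Fclass.
have xs0 : 0 < `|xs| ^+ 2.
  rewrite hard_min_norm// divr_gt0 ?exprn_gt0// mulr_gt0 ?Aseq_den_gt0//.
  exact: hard_weight_gt0.
have [n [call [step [v [s [[_ hk] v0 hs hv hu]]]]]] :=
  hA H f (fun=> 0%E) 0 ff (Fclass_cst0 _).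
apply: (@le_trans _ _ (`|A H f (fun=> 0%E) 0 - xs| ^+ 2 / `|0 - xs| ^+ 2)%:E).
  rewrite lee_fin sub0r normrN.
  apply: (@hard_fun_lower_bound _ _ _ _ _ e hmu hmuL he n call step v s) => //.
    by move=> l ln; have := hv l ln; rewrite subr0.
  by rewrite subr0 in hu.
apply: ereal_sup_ubound; exists H, f, (fun=> 0%E), xs, 0; split => //.
- exact: Fclass_cst0.
- by move=> x; rewrite !adde0 lee_fin; exact: hard_fun_argmin.
- by apply/eqP => x0; move: xs0; rewrite -x0 normr0 expr0n ltxx.
Qed.

Lemma risk_prox_item_le k :
  (risk mu L (prox_item mu L k) <= (1 / (1 + q * Aseq q k))%:E)%E.
Proof.
apply: ge_ereal_sup => _ [H [f [g [xs [u0 [ff gg hxs u0xs ->]]]]]].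
have d0 : 0 < `|u0 - xs| ^+ 2 by rewrite exprn_gt0// normr_gt0 subr_eq0.
rewrite lee_fin ler_pdivrMr// mulrAC mul1r ler_pdivlMr ?Aseq_den_gt0// mulrC.
exact: prox_item_rate.
Qed.

End RiskBounds.

Theorem theorem2 (R : realType) (mu L : R) (hmu : 0 < mu) (hmuL : mu < L)
    (k : nat) :
  let q := mu / L in
  ereal_inf [set r : \bar R | exists A : method R,
                 in_alg_class k mu L A /\ r = risk mu L A]
    = (1 / (1 + q * Aseq q k))%:E /\
  in_alg_class k mu L (prox_item mu L k) /\
  risk mu L (prox_item mu L k) = (1 / (1 + q * Aseq q k))%:E.
Proof.
move=> q.
have hin : in_alg_class k mu L (prox_item mu L k).
  by move=> H f g u0 _ _; exact: prox_item_admissible.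
have hrisk : risk mu L (prox_item mu L k) = (1 / (1 + q * Aseq q k))%:E.
  by apply/eqP; rewrite eq_le risk_prox_item_le//= risk_ge.
split; last by [].
apply/eqP; rewrite eq_le; apply/andP; split.
  by apply: ereal_inf_lbound; exists (prox_item mu L k).
by apply: le_ereal_inf_tmp => _ [A [hA ->]]; exact: risk_ge.
Qed.
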